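(* Let $k$ be a positive integer and let $z\in\mathbb{C}$ with $\Re(z)\ge 0$ and $z\ne 0$. Then $$\left|\frac{R_{k+1}(z)}{T_k(z)}\right| < \sqrt{\pi k}$$ and $$\left|\frac{R_{k}(z)}{T_k(z)}\right| < 1+ \sqrt{\pi k}.$$
   Context: $\log$ is the principal branch of the logarithm on $\mathbb{C}\setminus(-\infty,0]$. $\ln\Gamma$ denotes the analytic function on $\mathbb{C}\setminus(-\infty,0]$ with $\exp(\ln\Gamma(z))=\Gamma(z)$ that is real and equal to $\log(\Gamma(x))$ for real $x>0$. $B_{2j}$ are the Bernoulli numbers ($B_2=\frac16$, $B_4=-\frac1{30}$, etc.). For integers $j\ge1$, $$T_j(z) = \frac{B_{2j}}{2j(2j-1)z^{2j-1}},$$ and for integers $k\ge 1$ the remainder $R_k(z)$ in Stirling's approximation is defined by $$\ln\Gamma(z) = (z-\tfrac12)\log z - z + \tfrac12\log(2\pi) + \sum_{j=1}^{k-1} T_j(z) + R_k(z).$$ *)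

(* Defs.v *)
From Stdlib Require Import Reals Lra Lia List Factorial.
From Coquelicot Require Import Coquelicot.
Import ListNotations.
Open Scope R_scope.

(** Complex analysis is done on Coquelicot's [C]. Note that [C] hides the
    binomial coefficient of the standard library, which is written
    [Binomial.C] below. *)

(** * Exponential and principal logarithm *)

Definition Cexp (z : C) : C :=
  (exp (Re z) * cos (Im z), exp (Re z) * sin (Im z)).

(** The complement of the closed half-line (-oo, 0]. *)
Definition slit_plane (z : C) : Prop := ~ (Im z = 0 /\ Re z <= 0).

(** Half-angle formula: tan (arg z / 2) = Im z / (|z| + Re z). It gives the
    argument in (-PI, PI) for every [z] in the slit plane; the values elsewhere
    are irrelevant. *)
Definition Carg (z : C) : R := 2 * atan (Im z / (Cmod z + Re z)).

Definition Clog (z : C) : C := (ln (Cmod z), Carg z).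

Lemma slit_plane_denom_pos (z : C) : slit_plane z -> 0 < Cmod z + Re z.
Proof.
  destruct z as [x y]; unfold slit_plane, Cmod, Re, Im; cbn -[pow]; intros H.
  pose proof (sqrt_pos (x ^ 2 + y ^ 2)) as Hs.
  assert (Hq : 0 <= x ^ 2 + y ^ 2) by nra.
  pose proof (sqrt_sqrt _ Hq) as Hss.
  destruct (Req_dec y 0) as [Hy | Hy].
  - assert (0 < x) by (destruct (Rlt_dec 0 x); [easy | exfalso; apply H; lra]).
    lra.
  - assert (0 < y ^ 2) by (apply pow2_gt_0; easy).
    nra.
Qed.

Lemma Clog_Im_bounds (z : C) : - PI < Im (Clog z) < PI.
Proof.
  unfold Clog, Carg, Im; cbn.
  pose proof (atan_bound (snd z / (Cmod z + Re z))).
  lra.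
Qed.

Lemma Cexp_Clog (z : C) : slit_plane z -> Cexp (Clog z) = z.
Proof.
  intros H.
  pose proof (slit_plane_denom_pos z H) as Hd.
  assert (Hm : 0 < Cmod z).
  { apply Cmod_gt_0; intros ->; apply H; cbn; lra. }
  assert (Hsq : Cmod z * Cmod z = Re z * Re z + Im z * Im z).
  { unfold Cmod; rewrite sqrt_sqrt.
    - unfold Re, Im; ring.
    - pose proof (pow2_ge_0 (fst z)); pose proof (pow2_ge_0 (snd z)); lra. }
  unfold Cexp, Clog, Carg.
  change (Re (?a, ?b)) with a; change (Im (?a, ?b)) with b.
  rewrite exp_ln by easy.
  set (m := Cmod z) in *; set (x := Re z) in *; set (y := Im z) in *.
  set (t := y / (m + x)).
  rewrite cos_2a, sin_2a, cos_atan, sin_atan.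
  assert (Ht : 0 < 1 + t²) by (pose proof (Rle_0_sqr t); lra).
  pose proof (sqrt_lt_R0 _ Ht) as Hs.
  pose proof (sqrt_sqrt _ (Rlt_le _ _ Ht)) as Hss.
  set (s := sqrt (1 + t²)) in *.
  assert (Hty : t * (m + x) = y) by (unfold t; field; lra).
  assert (Hs2 : s * s * (m + x) = 2 * m).
  { apply (Rmult_eq_reg_r (m + x)); [ | lra ].
    rewrite Hss; unfold Rsqr.
    replace ((1 + t * t) * (m + x) * (m + x))
      with ((m + x) * (m + x) + t * (m + x) * (t * (m + x))) by ring.
    rewrite Hty; nra. }
  transitivity (x, y); [ | unfold x, y, Re, Im; destruct z; easy ].
  f_equal; apply (Rmult_eq_reg_r (s * s * (m + x))); try nra.
  - replace (m * (1 / s * (1 / s) - t / s * (t / s)) * (s * s * (m + x)))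
      with (m * ((m + x) - t * (t * (m + x)))) by (field; lra).
    apply (Rmult_eq_reg_r (m + x)); [ | lra ].
    replace (m * ((m + x) - t * (t * (m + x))) * (m + x))
      with (m * ((m + x) * (m + x) - t * (m + x) * (t * (m + x)))) by ring.
    rewrite Hty, Hs2; nra.
  - replace (m * (2 * (t / s) * (1 / s)) * (s * s * (m + x)))
      with (2 * m * (t * (m + x))) by (field; lra).
    rewrite Hty, Hs2; ring.
Qed.

(** * The Gamma function *)

Fixpoint rising (z : C) (n : nat) : C :=
  match n with
  | O => RtoC 1
  | S m => (rising z m * (z + INR m))%C
  end.

(** Euler's and Gauss's definition, valid on the whole domain of Gamma:
    Gamma(z) = lim n! n^z / (z (z+1) ... (z+n)),  where n^z = exp (z ln n). *)
Definition Gamma_seq (z : C) (n : nat) : C :=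
  (INR (fact n) * Cexp (z * ln (INR n)) / rising z (S n))%C.

Definition Gamma (z : C) : C :=
  (real (Lim_seq (fun n => Re (Gamma_seq z n))),
   real (Lim_seq (fun n => Im (Gamma_seq z n)))).

(** "Analytic" is complex differentiability at every point of the (open) slit
    plane. These conditions determine [L] on the slit plane, and say nothing
    about it elsewhere. *)
Definition is_ln_Gamma (L : C -> C) : Prop :=
  (forall z : C, slit_plane z -> @ex_derive C_AbsRing C_NormedModule L z) /\
  (forall z : C, slit_plane z -> Cexp (L z) = Gamma z) /\
  (forall x : R, 0 < x -> Im (L x) = 0 /\ L x = Clog (Gamma x)).

(** * Bernoulli numbers *)

(** The list [B_0; ...; B_(n-1)], by the recurrence
    sum_(j <= m) binomial (m+1) j * B_j = 0  for m >= 1,  B_0 = 1. *)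
Fixpoint bernoulli_list (n : nat) : list R :=
  match n with
  | O => []
  | S m =>
      let l := bernoulli_list m in
      l ++ [match m with
            | O => 1
            | S p =>
                - sum_f_R0 (fun j => Binomial.C (S m) j * nth j l 0) p
                / INR (S m)
            end]
  end.

Definition bernoulli (n : nat) : R := nth n (bernoulli_list (S n)) 0.

Lemma bernoulli_list_length (n : nat) : length (bernoulli_list n) = n.
Proof.
  induction n as [ | n IH]; [easy | ].
  cbn [bernoulli_list]; rewrite length_app, IH; cbn; lia.
Qed.

Lemma nth_bernoulli_list (n j : nat) :
  (j < n)%nat -> nth j (bernoulli_list n) 0 = bernoulli j.
Proof.
  induction n as [ | n IH]; [lia | ]; intros Hj.
  destruct (Nat.eq_dec j n) as [-> | Hne]; [easy | ].
  cbn [bernoulli_list]; rewrite app_nth1.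
  - apply IH; lia.
  - rewrite bernoulli_list_length; lia.
Qed.

Lemma bernoulli_0 : bernoulli 0 = 1.
Proof. easy. Qed.

Lemma bernoulli_S (p : nat) :
  bernoulli (S p) =
  - sum_f_R0 (fun j => Binomial.C (S (S p)) j * bernoulli j) p / INR (S (S p)).
Proof.
  unfold bernoulli at 1; cbn [bernoulli_list].
  change (bernoulli_list p ++ _) with (bernoulli_list (S p)).
  rewrite app_nth2; rewrite bernoulli_list_length; [ | lia ].
  rewrite Nat.sub_diag; cbn [nth].
  do 2 f_equal; apply sum_eq; intros i Hi.
  now rewrite nth_bernoulli_list by lia.
Qed.

Lemma bernoulli_2 : bernoulli 2 = 1 / 6.
Proof.
  rewrite !bernoulli_S; cbn [sum_f_R0]; rewrite !bernoulli_S; cbn [sum_f_R0].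
  rewrite bernoulli_0; unfold Binomial.C; cbn; field.
Qed.

(** * Stirling's series *)

Definition T (j : nat) (z : C) : C :=
  (RtoC (bernoulli (2 * j))
   / (RtoC (INR (2 * j * (2 * j - 1))) * z ^ (2 * j - 1)))%C.

(** [sum_n_m T 1 (k - 1)] is the empty sum when [k = 1]. *)
Definition stirling_remainder (L : C -> C) (k : nat) (z : C) : C :=
  (L z - ((z - 1 / 2) * Clog z - z + 1 / 2 * ln (2 * PI)
          + sum_n_m (fun j => T j z) 1 (k - 1)))%C.

(* Main.v *)
Require Import Defs.
From Stdlib Require Import Reals Lra Lia Psatz Factorial Ranalysis5.
From Coquelicot Require Import Coquelicot.
Open Scope R_scope.

(** The remainder has the representation
      R_(k+1)(z) = - int_0^oo B_2k({u}) / (2k (z + u)^(2k)) du,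
    where [{u}] is the fractional part. Two facts turn it into the bound. First,
    [|B_2k(x)| <= |B_2k|] on [[0, 1]] ([bpoly_even_le]). Second,
    [|z + u|^2 >= |z|^2 + u^2] when [Re z >= 0]. The substitution
    [u = |z| tan x] then gives
      |R_(k+1)(z) / T_k(z)| <= (2k - 1) int_0^(PI/2) cos^(2k-2) = 2k W_2k,
    where [W_n] is the integral of [cos^n] from 0 to [PI/2], and Wallis's identity
    [2k W_(2k-1) W_2k = PI/2] together with [W_2k < W_(2k-1)] gives
    [2k W_2k < sqrt (PI k)] ([wallis_even_lt]). The second inequality follows
    because [R_k = R_(k+1) + T_k].

    The integral over the half-line is avoided: each unit interval contributes one
    step of the Euler-Maclaurin formula ([em_prim_increment]), bounded by the
    increment of a real primitive ([stirling_step_le]), and these increments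
    telescope ([em_defect_le]).

    The remaining work is to link these sums to the given analytic logarithm of
    Gamma. The logarithm of the Euler-Gauss sequence,
      ln n! + z ln n - sum_(j <= n) Log (z + j),
    differs from Stirling's approximation at [z] by the Euler-Maclaurin error and a
    quantity that tends to 0 ([log_Gamma_seq_gap_le]); the constant
    [ln (2 PI) / 2] enters there, by Wallis's product
    ([is_lim_seq_stirling_defect]). Hence the sequence converges, and its limit is
    a logarithm of Gamma. It is the given one, because the two agree at 1
    and their difference, an integer multiple of [2 PI i], cannot jump along
    a segment ([ln_Gamma_eq_lim]). *)

(** * Derivatives of complex functions of a real variable *)

(** Componentwise, so that every differentiation rule reduces to one for real
    functions. *)
Definition is_Cderive (f : R -> C) (x : R) (l : C) : Prop :=
  is_derive (fun t => Re (f t)) x (Re l) /\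
  is_derive (fun t => Im (f t)) x (Im l).

Lemma is_Cderive_ext (f g : R -> C) (x : R) (l : C) :
  (forall t, f t = g t) -> is_Cderive f x l -> is_Cderive g x l.
Proof.
  intros E [H1 H2]; split.
  - apply is_derive_ext with (2 := H1); intros t; now rewrite E.
  - apply is_derive_ext with (2 := H2); intros t; now rewrite E.
Qed.

Lemma is_Cderive_line (a b : C) (x : R) :
  is_Cderive (fun t => a + RtoC t * b)%C x b.
Proof.
  destruct a as [a1 a2], b as [b1 b2]; split; cbn; auto_derive; trivial; ring.
Qed.

Lemma is_Cderive_real (g : R -> R) (x l : R) :
  is_derive g x l -> is_Cderive (fun t => RtoC (g t)) x (RtoC l).
Proof.
  intros H; split; cbn; [exact H | apply is_derive_Reals, derivable_pt_lim_const].
Qed.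

Lemma is_Cderive_plus (f g : R -> C) (x : R) (l m : C) :
  is_Cderive f x l -> is_Cderive g x m ->
  is_Cderive (fun t => f t + g t)%C x (l + m)%C.
Proof.
  intros [H1 H2] [H3 H4]; split; cbn.
  - exact (is_derive_plus _ _ _ _ _ H1 H3).
  - exact (is_derive_plus _ _ _ _ _ H2 H4).
Qed.

Lemma is_Cderive_minus (f g : R -> C) (x : R) (l m : C) :
  is_Cderive f x l -> is_Cderive g x m ->
  is_Cderive (fun t => f t - g t)%C x (l - m)%C.
Proof.
  intros [H1 H2] [H3 H4]; split; cbn.
  - exact (is_derive_minus _ _ _ _ _ H1 H3).
  - exact (is_derive_minus _ _ _ _ _ H2 H4).
Qed.

Lemma is_Cderive_mult (f g : R -> C) (x : R) (l m : C) :
  is_Cderive f x l -> is_Cderive g x m ->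
  is_Cderive (fun t => f t * g t)%C x (l * g x + f x * m)%C.
Proof.
  assert (Hm : forall (p q : R -> R) (dp dq : R),
    is_derive p x dp -> is_derive q x dq ->
    is_derive (fun t => p t * q t) x (dp * q x + p x * dq)).
  { intros p q dp dq Hp Hq; apply (is_derive_mult p q); try easy.
    intros; apply Rmult_comm. }
  intros [H1 H2] [H3 H4]; split.
  - evar_last.
    + exact (is_derive_minus _ _ _ _ _ (Hm _ _ _ _ H1 H3) (Hm _ _ _ _ H2 H4)).
    + unfold minus, plus, opp, Re, Im; cbn; ring.
  - evar_last.
    + exact (is_derive_plus _ _ _ _ _ (Hm _ _ _ _ H1 H4) (Hm _ _ _ _ H2 H3)).
    + unfold plus, Re, Im; cbn; ring.
Qed.

Lemma Csqr_norm_pos (z : C) : z <> RtoC 0 -> 0 < Re z * Re z + Im z * Im z.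
Proof.
  intros Hz; destruct z as [x y]; cbn.
  destruct (Req_dec x 0) as [-> | Hx]; [ | nra].
  destruct (Req_dec y 0) as [-> | Hy]; [now elim Hz | nra].
Qed.

Lemma is_derive_quot_sqr_norm (p q : R -> R) (x dp dq : R) :
  is_derive p x dp -> is_derive q x dq -> 0 < p x * p x + q x * q x ->
  is_derive (fun t => p t / (p t * p t + q t * q t)) x
    ((dp * (q x * q x - p x * p x) - 2 * p x * q x * dq)
     / ((p x * p x + q x * q x) * (p x * p x + q x * q x))).
Proof.
  intros H1 H2 Hn.
  assert (E1 : Derive (fun t : R => p t) x = dp) by exact (is_derive_unique _ _ _ H1).
  assert (E2 : Derive (fun t : R => q t) x = dq) by exact (is_derive_unique _ _ _ H2).
  assert (ex_derive p x) by (eexists; eassumption).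
  assert (ex_derive q x) by (eexists; eassumption).
  auto_derive; [repeat split; trivial; lra | ].
  rewrite E1, E2; field; lra.
Qed.

Lemma is_Cderive_inv (f : R -> C) (x : R) (l : C) :
  f x <> RtoC 0 -> is_Cderive f x l ->
  is_Cderive (fun t => / f t)%C x (- (l * (/ f x * / f x)))%C.
Proof.
  intros Hf [H1 H2].
  pose proof (Csqr_norm_pos _ Hf) as Hn.
  split.
  - apply (is_derive_ext
      (fun t => Re (f t) / (Re (f t) * Re (f t) + Im (f t) * Im (f t)))).
    { intros t; unfold Cinv, Re, Im; cbn; do 2 f_equal; ring. }
    evar_last; [apply (is_derive_quot_sqr_norm _ _ _ _ _ H1 H2 Hn) | ].
    unfold Cinv, Cmult, Copp, Re, Im in *; cbn in *; field; lra.
  - apply (is_derive_ext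
      (fun t => - (Im (f t) / (Im (f t) * Im (f t) + Re (f t) * Re (f t))))).
    { intros t; unfold Cinv, Re, Im, Rdiv; cbn.
      rewrite Ropp_mult_distr_l; do 2 f_equal; ring. }
    rewrite Rplus_comm in Hn.
    evar_last.
    + exact (is_derive_opp _ _ _ (is_derive_quot_sqr_norm _ _ _ _ _ H2 H1 Hn)).
    + unfold opp, Cinv, Cmult, Copp, Re, Im in *; cbn in *; field; lra.
Qed.

Lemma Cmod_sqr (z : C) : Cmod z * Cmod z = Re z * Re z + Im z * Im z.
Proof.
  unfold Cmod; rewrite sqrt_sqrt.
  - unfold Re, Im; ring.
  - pose proof (pow2_ge_0 (fst z)); pose proof (pow2_ge_0 (snd z)); lra.
Qed.

(** The derivative of the argument of [(p, q)], through the half-angle formula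
    that defines [Carg]. *)
Lemma is_derive_half_angle (p q : R -> R) (x dp dq m : R) :
  is_derive p x dp -> is_derive q x dq ->
  m = sqrt (p x * p x + q x * q x) -> 0 < m -> 0 < m + p x ->
  is_derive (fun t => 2 * atan (q t / (sqrt (p t * p t + q t * q t) + p t))) x
    ((dq * p x - dp * q x) / (m * m)).
Proof.
  intros H1 H2 Em Hm Hd.
  assert (E1 : Derive (fun t : R => p t) x = dp) by exact (is_derive_unique _ _ _ H1).
  assert (E2 : Derive (fun t : R => q t) x = dq) by exact (is_derive_unique _ _ _ H2).
  assert (ex_derive p x) by (eexists; eassumption).
  assert (ex_derive q x) by (eexists; eassumption).
  assert (Hn : 0 < p x * p x + q x * q x).
  { destruct (Rle_lt_dec (p x * p x + q x * q x) 0) as [Hle | ]; [ | easy].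
    rewrite (sqrt_neg_0 _ Hle) in Em; lra. }
  assert (Hmm : m * m = p x * p x + q x * q x).
  { rewrite Em; apply sqrt_sqrt; lra. }
  auto_derive; [repeat split; trivial; rewrite <- Em; lra | ].
  rewrite <- Em, E1, E2; clear Em E1 E2.
  revert Hmm Hd; generalize (p x) (q x); intros a b Hmm Hd.
  assert (Hq : b * b = m * m - a * a) by lra.
  (* With b^2 = m^2 - a^2, the denominator (m + a)^2 + b^2 is 2m(m + a). *)
  assert (Hq2 : (m + a) * (m + a) + b * b = 2 * m * (m + a)) by (rewrite Hq; ring).
  replace (1 + (b / (m + a)) ^ 2) with (2 * m * (m + a) / ((m + a) * (m + a))).
  2: { rewrite <- Hq2; field; lra. }
  field_simplify_eq; [ | repeat split; [lra | lra | rewrite Hq2; nra] ].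
  replace (b ^ 3) with (b * (m * m - a * a)) by (rewrite <- Hq; ring).
  replace (b ^ 2) with (m * m - a * a) by (rewrite <- Hq; ring); ring.
Qed.

Lemma is_Cderive_Clog (f : R -> C) (x : R) (l : C) :
  slit_plane (f x) -> is_Cderive f x l ->
  is_Cderive (fun t => Clog (f t)) x (l / f x)%C.
Proof.
  intros Hs [H1 H2].
  pose proof (slit_plane_denom_pos _ Hs) as Hd.
  assert (H0 : f x <> RtoC 0) by (intros E; apply Hs; rewrite E; cbn; lra).
  pose proof (Csqr_norm_pos _ H0) as Hn.
  pose proof (Cmod_sqr (f x)) as Hm.
  assert (Hm0 : 0 < Cmod (f x)) by now apply Cmod_gt_0.
  assert (Em : forall t,
    sqrt (Re (f t) * Re (f t) + Im (f t) * Im (f t)) = Cmod (f t)).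
  { intros t; unfold Cmod; f_equal; unfold Re, Im; ring. }
  split.
  - apply (is_derive_ext
      (fun t => ln (sqrt (Re (f t) * Re (f t) + Im (f t) * Im (f t))))).
    { intros t; now rewrite Em. }
    assert (Hln : forall (p q : R -> R) (dp dq : R),
      is_derive p x dp -> is_derive q x dq -> 0 < p x * p x + q x * q x ->
      is_derive (fun t => ln (sqrt (p t * p t + q t * q t))) x
        ((dp * p x + dq * q x) / (p x * p x + q x * q x))).
    { intros p q dp dq Hp Hq Hpq.
      pose proof (sqrt_lt_R0 _ Hpq).
      assert (E1 : Derive (fun t : R => p t) x = dp) by exact (is_derive_unique _ _ _ Hp).
      assert (E2 : Derive (fun t : R => q t) x = dq) by exact (is_derive_unique _ _ _ Hq).
      assert (ex_derive p x) by (eexists; eassumption).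
      assert (ex_derive q x) by (eexists; eassumption).
      auto_derive; [repeat split; trivial; lra | ].
      rewrite E1, E2.
      transitivity ((dp * p x + dq * q x) /
        (sqrt (p x * p x + q x * q x) * sqrt (p x * p x + q x * q x))).
      - field; lra.
      - now rewrite sqrt_sqrt by lra. }
    evar_last; [exact (Hln _ _ _ _ H1 H2 Hn) | ].
    unfold Cdiv, Cinv, Cmult, Re, Im in *; cbn in *; field; lra.
  - apply (is_derive_ext
      (fun t => 2 * atan (Im (f t) /
         (sqrt (Re (f t) * Re (f t) + Im (f t) * Im (f t)) + Re (f t))))).
    { intros t; rewrite Em; unfold Clog, Carg; easy. }
    evar_last.
    + exact (is_derive_half_angle _ _ _ _ _ _ H1 H2 (eq_sym (Em x)) Hm0 Hd).
    + rewrite Hm; unfold Cdiv, Cinv, Cmult, Re, Im in *; cbn in *; field; lra.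
Qed.

(** * The mean value inequality and the principal logarithm *)

Lemma is_derive_nonpos_le (h dh : R -> R) (a b : R) :
  a <= b -> (forall x, a <= x <= b -> is_derive h x (dh x)) ->
  (forall x, a < x < b -> dh x <= 0) -> h b <= h a.
Proof.
  intros Hab Hd Hneg.
  destruct (Rle_lt_or_eq_dec _ _ Hab) as [Hlt | ->]; [ | lra].
  destruct (MVT_cor2 h dh a b Hlt) as [c [E Hc]].
  { intros c Hc; apply is_derive_Reals, Hd, Hc. }
  specialize (Hneg c Hc); nra.
Qed.

(** The mean value theorem fails for complex functions, but it applies to the
    component of [f] along its own increment [f b - f a]. *)
Lemma Cmod_increment_le (f df : R -> C) (g dg : R -> R) (a b : R) :
  a <= b ->
  (forall x, a <= x <= b -> is_Cderive f x (df x)) ->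
  (forall x, a <= x <= b -> is_derive g x (dg x)) ->
  (forall x, a < x < b -> Cmod (df x) <= dg x) ->
  Cmod (f b - f a)%C <= g b - g a.
Proof.
  intros Hab Hf Hg Hle.
  set (e := (f b - f a)%C).
  pose (h := fun x => Re e * Re (f x) + Im e * Im (f x) - Cmod e * g x).
  assert (Hh : h b <= h a).
  { apply (is_derive_nonpos_le h
      (fun x => Re e * Re (df x) + Im e * Im (df x) - Cmod e * dg x) a b Hab).
    - intros x Hx; destruct (Hf x Hx) as [H1 H2]; specialize (Hg x Hx).
      exact (is_derive_minus _ _ _ _ _
        (is_derive_plus _ _ _ _ _ (is_derive_scal _ _ (Re e) _ H1)
                                  (is_derive_scal _ _ (Im e) _ H2))
        (is_derive_scal _ _ (Cmod e) _ Hg)).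
    - intros x Hx; specialize (Hle x Hx).
      assert (Hcs : Re e * Re (df x) + Im e * Im (df x) <= Cmod e * Cmod (df x)).
      { rewrite <- (Cmod_conj e), <- Cmod_mult.
        eapply Rle_trans; [ | apply re_le_Cmod].
        eapply Rle_trans; [ | apply Rle_abs].
        right; unfold Cconj, Re, Im; cbn; ring. }
      pose proof (Cmod_ge_0 e); nra. }
  unfold h in Hh.
  pose proof (Cmod_sqr e) as He.
  assert (E1 : Re e = Re (f b) - Re (f a)) by easy.
  assert (E2 : Im e = Im (f b) - Im (f a)) by easy.
  destruct (Rle_lt_or_eq_dec _ _ (Cmod_ge_0 e)) as [Hp | Hz].
  - apply (Rmult_le_reg_l (Cmod e)); [easy | ].
    assert (E : Cmod e * Cmod e =
      Re e * (Re (f b) - Re (f a)) + Im e * (Im (f b) - Im (f a))).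
    { now rewrite He, <- E1, <- E2. }
    nra.
  - rewrite <- Hz.
    cut (- g b <= - g a); [lra | ].
    apply (is_derive_nonpos_le (fun x => - g x) (fun x => - dg x) a b Hab).
    + intros x Hx; exact (is_derive_opp _ _ _ (Hg x Hx)).
    + intros x Hx; specialize (Hle x Hx); pose proof (Cmod_ge_0 (df x)); lra.
Qed.

Lemma slit_plane_Re_nonneg (z : C) : 0 <= Re z -> z <> RtoC 0 -> slit_plane z.
Proof.
  intros Hr Hz [Hi Hle]; apply Hz.
  destruct z as [x y]; unfold Re, Im in *; cbn in *.
  apply injective_projections; cbn; lra.
Qed.

Lemma Re_nonneg_shift (z : C) (u : R) :
  0 <= Re z -> z <> RtoC 0 -> 0 <= u ->
  0 <= Re (z + u)%C /\ (z + u)%C <> RtoC 0.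
Proof.
  intros Hre Hz Hu; split; [unfold Re in *; cbn; lra | ].
  intros E; apply Hz.
  apply (f_equal Re) in E as E1; apply (f_equal Im) in E as E2.
  destruct z as [x y]; unfold Re, Im in *; cbn in *.
  apply injective_projections; cbn; lra.
Qed.

Lemma Re_pos_neq_0 (z : C) : 0 < Re z -> z <> RtoC 0.
Proof. intros H E; rewrite E in H; cbn in H; lra. Qed.

Lemma Re_le_Cmod (z : C) : Re z <= Cmod z.
Proof. eapply Rle_trans; [apply Rle_abs | apply re_le_Cmod]. Qed.

Lemma Clog_real (x : R) : 0 < x -> Clog (RtoC x) = RtoC (ln x).
Proof.
  intros Hx; unfold Clog, Carg, RtoC; cbn.
  replace (0 / (Cmod (x, 0) + x)) with 0 by (unfold Rdiv; ring).
  rewrite atan_0, Rmult_0_r.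
  change (x, 0) with (RtoC x); rewrite Cmod_R, Rabs_pos_eq by lra; easy.
Qed.

Lemma Clog_scal (r : R) (z : C) :
  0 < r -> slit_plane z -> Clog (RtoC r * z)%C = (RtoC (ln r) + Clog z)%C.
Proof.
  intros Hr Hz.
  pose proof (slit_plane_denom_pos z Hz) as Hd.
  assert (H0 : z <> RtoC 0) by (intros E; apply Hz; rewrite E; cbn; lra).
  unfold Clog, Carg, RtoC, Cplus; cbn -[Cmult].
  rewrite Cmod_mult.
  change (r, 0) with (RtoC r); rewrite Cmod_R, Rabs_pos_eq by lra.
  apply injective_projections; cbn.
  - apply ln_mult; [easy | now apply Cmod_gt_0].
  - rewrite Rplus_0_l; do 2 f_equal; unfold Re, Im in *; field.
    rewrite <- Rmult_plus_distr_l.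
    split; [lra | apply Rgt_not_eq, Rmult_lt_0_compat; lra].
Qed.

Lemma is_Cderive_Clog_shift (z : C) (u : R) :
  slit_plane (z + RtoC u)%C ->
  is_Cderive (fun t => Clog (z + RtoC t))%C u (/ (z + RtoC u))%C.
Proof.
  intros H.
  apply is_Cderive_ext with (fun t => Clog (z + RtoC t * RtoC 1))%C.
  { intros t; now rewrite Cmult_1_r. }
  replace (/ (z + RtoC u))%C with (RtoC 1 / (z + RtoC u * RtoC 1))%C.
  - apply is_Cderive_Clog; [ | apply is_Cderive_line].
    now rewrite Cmult_1_r.
  - rewrite Cmult_1_r; unfold Cdiv; now rewrite Cmult_1_l.
Qed.

(** On the segment from 0 to [w], the derivative of [Clog (1 + t w) - t w] is
    [- t w^2 / (1 + t w)], and [|1 + t w| >= 1] in the right half-plane. *)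
Lemma Clog_1p_minus_id_le (w : C) :
  0 <= Re w -> Cmod (Clog (RtoC 1 + w) - w)%C <= Cmod w * Cmod w / 2.
Proof.
  intros Hw.
  assert (Hre : forall t, 0 <= t -> 1 <= Re (RtoC 1 + RtoC t * w)%C).
  { intros t Ht; unfold Re in *; cbn; nra. }
  assert (Hslit : forall t, 0 <= t -> slit_plane (RtoC 1 + RtoC t * w)%C).
  { intros t Ht [_ H]; specialize (Hre t Ht); lra. }
  pose (f := fun t : R => (Clog (RtoC 1 + RtoC t * w) - (RtoC 0 + RtoC t * w))%C).
  pose proof (Cmod_increment_le f
    (fun t => w / (RtoC 1 + RtoC t * w) - w)%C
    (fun t => t ^ 2 * (Cmod w * Cmod w / 2)) (fun t => t * (Cmod w * Cmod w))
    0 1 ltac:(lra)) as H.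
  replace (Clog (RtoC 1 + w) - w)%C with (f 1 - f 0)%C.
  - eapply Rle_trans; [apply H | lra]; clear H.
    + intros t Ht; apply is_Cderive_minus; [ | apply is_Cderive_line].
      apply is_Cderive_Clog; [apply Hslit; lra | apply is_Cderive_line].
    + intros t Ht; auto_derive; [easy | field].
    + intros t Ht.
      specialize (Hre t ltac:(lra)).
      set (d := (RtoC 1 + RtoC t * w)%C) in *.
      assert (Hd : d <> RtoC 0) by (apply Re_pos_neq_0; lra).
      replace (w / d - w)%C with (- (RtoC t * (w * w)) * / d)%C.
      2: { unfold d in *; field; easy. }
      rewrite Cmod_mult, Cmod_opp, !Cmod_mult, Cmod_inv, Cmod_R by easy.
      rewrite Rabs_pos_eq by lra.
      pose proof (Re_le_Cmod d) as Hm.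
      rewrite <- (Rmult_1_r (t * (Cmod w * Cmod w))) at 2.
      apply Rmult_le_compat_l.
      * pose proof (Cmod_ge_0 w); apply Rmult_le_pos; nra.
      * rewrite <- Rinv_1; apply Rinv_le_contravar; lra.
  - unfold f; rewrite !Cmult_0_l, !Cmult_1_l, Cplus_0_r, Clog_real, ln_1 by lra.
    ring.
Qed.

(** * Bernoulli polynomials on the unit interval *)

(** The Bernoulli polynomial divided by [n!]: with this normalization,
    differentiation lowers the index without a factor. *)
Definition bpoly (n : nat) (x : R) : R :=
  sum_f_R0 (fun j => bernoulli j / INR (fact j)
                     * (x ^ (n - j) / INR (fact (n - j)))) n.

Lemma is_derive_div_pow (m : nat) (x : R) :
  is_derive (fun t => t ^ S m / INR (fact (S m))) x (x ^ m / INR (fact m)).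
Proof.
  assert (H1 := INR_fact_neq_0 m).
  assert (H2 : INR (S m) <> 0) by (apply not_0_INR; lia).
  auto_derive; [easy | ].
  change (fact m + m * fact m)%nat with (S m * fact m)%nat.
  rewrite mult_INR; change (match m with O => 1 | S _ => INR m + 1 end) with (INR (S m)).
  field; easy.
Qed.

Lemma is_derive_bpoly (n : nat) (x : R) : is_derive (bpoly (S n)) x (bpoly n x).
Proof.
  unfold bpoly.
  apply (is_derive_ext (fun t =>
    sum_f_R0 (fun j => bernoulli j / INR (fact j)
                       * (t ^ (S n - j) / INR (fact (S n - j)))) n
    + bernoulli (S n) / INR (fact (S n)))).
  { intros t; rewrite tech5, Nat.sub_diag; cbn [pow fact INR].
    unfold Rdiv; rewrite Rinv_1, !Rmult_1_r; easy. }
  rewrite <- (Rplus_0_r (sum_f_R0 _ n)).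
  apply (is_derive_plus (fun t => sum_f_R0 _ n));
    [ | apply is_derive_Reals, derivable_pt_lim_const].
  assert (H : forall N, (N <= n)%nat -> is_derive (fun t =>
    sum_f_R0 (fun j => bernoulli j / INR (fact j)
                       * (t ^ (S n - j) / INR (fact (S n - j)))) N) x
    (sum_f_R0 (fun j => bernoulli j / INR (fact j)
                       * (x ^ (n - j) / INR (fact (n - j)))) N)).
  { intros N; induction N as [ | N IH]; intros HN; cbn [sum_f_R0].
    - rewrite !Nat.sub_0_r; apply is_derive_scal, is_derive_div_pow.
    - apply (is_derive_plus (fun t => sum_f_R0 _ N)); [apply IH; lia | ].
      apply is_derive_scal.
      replace (S n - S N)%nat with (S (n - S N)) by lia; apply is_derive_div_pow. }
  now apply H.
Qed.

Lemma bpoly_0_l (x : R) : bpoly 0 x = 1.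
Proof. unfold bpoly; cbn -[bernoulli]; rewrite bernoulli_0; field. Qed.

Lemma bpoly_at_0 (n : nat) : bpoly n 0 = bernoulli n / INR (fact n).
Proof.
  assert (Hlast : forall c, c * (0 ^ 0 / INR (fact 0)) = c) by (intros; cbn; field).
  unfold bpoly; destruct n as [ | n].
  - cbn [sum_f_R0 Nat.sub]; apply Hlast.
  - rewrite tech5, Nat.sub_diag, Hlast, sum_eq_R0; [ring | ].
    intros j Hj; replace (S n - j)%nat with (S (n - j)) by lia.
    rewrite pow_ne_zero by lia; unfold Rdiv; ring.
Qed.

(** This is the recurrence that defines the Bernoulli numbers. *)
Lemma bpoly_at_1 (n : nat) : (2 <= n)%nat -> bpoly n 1 = bpoly n 0.
Proof.
  intros Hn; destruct n as [ | [ | p]]; try lia.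
  rewrite bpoly_at_0; unfold bpoly; rewrite tech5, Nat.sub_diag.
  rewrite <- Rplus_0_l; f_equal.
  2: { cbn [pow]; change (INR (fact 0)) with 1; field; apply INR_fact_neq_0. }
  set (n := S (S p)).
  apply (Rmult_eq_reg_l (INR (fact n))); [ | apply INR_fact_neq_0].
  rewrite Rmult_0_r, scal_sum.
  rewrite (sum_eq _ (fun j => Binomial.C n j * bernoulli j)).
  2: { intros j _; rewrite pow1; unfold Binomial.C; field.
       split; apply INR_fact_neq_0. }
  rewrite tech5, bernoulli_S.
  replace (Binomial.C n (S p)) with (INR n).
  2: { unfold Binomial.C, n; replace (S (S p) - S p)%nat with 1%nat by lia.
       change (fact (S (S p))) with (S (S p) * fact (S p))%nat; rewrite mult_INR.
       change (INR (fact 1)) with 1; field; apply INR_fact_neq_0. }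
  fold n; field; apply not_0_INR; unfold n; lia.
Qed.

(** If [D n] vanishes then [D (S n)] is a constant, hence [D (S (S n))] is affine;
    as it takes the same value at [a] and [b], that constant is 0. Identities
    between Bernoulli polynomials follow when [D n] is the difference of the two
    sides. *)
Lemma Appell_zero (D : nat -> R -> R) (c a b : R) :
  c <> 0 -> a < b -> (forall x, D 0%nat x = 0) ->
  (forall n x, is_derive (D (S n)) x (c * D n x)) ->
  (forall n, D (S (S n)) a = D (S (S n)) b) ->
  forall n x, D n x = 0.
Proof.
  intros Hc Hab H0 Hd He n; induction n as [ | n IH]; [easy | ].
  assert (Hconst : forall x y, x < y -> D (S n) x = D (S n) y).
  { intros x y Hxy.
    destruct (MVT_cor2 (D (S n)) (fun t => c * D n t) x y Hxy) as [t [E _]].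
    - intros; apply is_derive_Reals, Hd.
    - rewrite IH in E; lra. }
  assert (Ha : D (S n) a = 0).
  { destruct (MVT_cor2 (D (S (S n))) (fun t => c * D (S n) t) a b Hab) as [t [E Ht]].
    - intros; apply is_derive_Reals, Hd.
    - rewrite He, Rminus_diag, <- (Hconst a t) in E by lra.
      destruct (Rmult_integral _ _ (eq_sym E)) as [E' | ?]; [ | lra].
      now destruct (Rmult_integral _ _ E'). }
  intros x; destruct (Rtotal_order x a) as [H | [-> | H]]; [ | easy | ].
  - now rewrite (Hconst x a).
  - now rewrite <- (Hconst a x).
Qed.

Lemma is_derive_bpoly_affine (n : nat) (p q x : R) :
  is_derive (fun t => bpoly (S n) (p * t + q)) x (p * bpoly n (p * x + q)).
Proof.
  apply (is_derive_comp (bpoly (S n)) (fun t => p * t + q)).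
  - apply is_derive_bpoly.
  - auto_derive; [easy | ring].
Qed.

Lemma bpoly_reflection (n : nat) (x : R) : bpoly n (1 - x) = (-1) ^ n * bpoly n x.
Proof.
  assert (H : bpoly n ((-1) * x + 1) - (-1) ^ n * bpoly n x = 0).
  { apply (Appell_zero (fun n x => bpoly n ((-1) * x + 1) - (-1) ^ n * bpoly n x)
             (-1) 0 1); try lra; clear.
    - intros x; rewrite !bpoly_0_l; cbn; ring.
    - intros n x; evar_last.
      + apply (is_derive_minus (fun t => bpoly (S n) ((-1) * t + 1))).
        * apply is_derive_bpoly_affine.
        * apply is_derive_scal, is_derive_bpoly.
      + unfold minus, plus, opp; cbn; ring.
    - intros n; rewrite Rmult_0_r, Rmult_1_r, Rplus_0_l.
      replace (-1 + 1) with 0 by ring.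
      rewrite bpoly_at_1 by lia; ring. }
  replace (1 - x) with ((-1) * x + 1) by ring; lra.
Qed.

Lemma bpoly_duplication (n : nat) (x : R) :
  2 * bpoly n (2 * x) = 2 ^ n * (bpoly n x + bpoly n (x + 1 / 2)).
Proof.
  assert (H : 2 * bpoly n (2 * x + 0)
              - 2 ^ n * (bpoly n x + bpoly n (1 * x + 1 / 2)) = 0).
  { apply (Appell_zero (fun n x => 2 * bpoly n (2 * x + 0)
              - 2 ^ n * (bpoly n x + bpoly n (1 * x + 1 / 2)))
             2 0 (1 / 2)); try lra; clear.
    - intros x; rewrite !bpoly_0_l; cbn; ring.
    - intros n x; evar_last.
      + apply (is_derive_minus (fun t => 2 * bpoly (S n) (2 * t + 0))).
        * apply is_derive_scal, is_derive_bpoly_affine.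
        * apply is_derive_scal, (is_derive_plus (bpoly (S n))).
          -- apply is_derive_bpoly.
          -- apply is_derive_bpoly_affine.
      + unfold minus, plus, opp; cbn; ring.
    - intros n; rewrite !Rmult_0_r, !Rplus_0_l, Rplus_0_r, !Rmult_1_l.
      replace (2 * (1 / 2)) with 1 by field.
      replace (1 / 2 + 1 / 2) with 1 by field.
      rewrite bpoly_at_1 by lia; ring. }
  rewrite Rplus_0_r, Rmult_1_l in H; lra.
Qed.

(** Duplication at 0 gives the factor [2^(1-n) - 1], which lies in [[-1, 0]]. *)
Lemma bpoly_half_le (n : nat) :
  (1 <= n)%nat -> Rabs (bpoly n (1 / 2)) <= Rabs (bpoly n 0).
Proof.
  intros Hn; pose proof (bpoly_duplication n 0) as H.
  rewrite Rmult_0_r, Rplus_0_l in H.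
  assert (H2 : 2 <= 2 ^ n).
  { replace 2 with (2 ^ 1) at 1 by ring; apply Rle_pow; [lra | easy]. }
  set (P := 2 ^ n) in *; set (v := bpoly n 0) in *; set (h := bpoly n (1 / 2)) in *.
  apply (Rmult_le_reg_l P); [lra | ].
  rewrite <- (Rabs_pos_eq P) at 1 by lra; rewrite <- Rabs_mult.
  replace (P * h) with (- ((P - 2) * v)) by nra.
  rewrite Rabs_Ropp, Rabs_mult, Rabs_pos_eq by lra.
  pose proof (Rabs_pos v); nra.
Qed.

Lemma bpoly_odd_half (k : nat) : bpoly (2 * k + 1) (1 / 2) = 0.
Proof.
  pose proof (bpoly_reflection (2 * k + 1) (1 / 2)) as H.
  replace (1 - 1 / 2) with (1 / 2) in H by field.
  rewrite Nat.add_1_r, pow_1_odd in H; rewrite Nat.add_1_r; lra.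
Qed.

Lemma bpoly_odd_0 (k : nat) : (1 <= k)%nat -> bpoly (2 * k + 1) 0 = 0.
Proof.
  intros Hk; pose proof (bpoly_reflection (2 * k + 1) 0) as H.
  rewrite Rminus_0_r, bpoly_at_1 in H by lia.
  rewrite Nat.add_1_r, pow_1_odd in H; rewrite Nat.add_1_r; lra.
Qed.

(** The derivative [g] is nonincreasing, so a negative value of [h] between the two
    zeros would force [g] to be negative and then positive. *)
Lemma concave_between_zeros (h g : R -> R) (a b : R) :
  h a = 0 -> h b = 0 ->
  (forall x, is_derive h x (g x)) ->
  (forall x y, a <= x -> x <= y -> y <= b -> g y <= g x) ->
  forall x, a <= x <= b -> 0 <= h x.
Proof.
  intros Ha Hb Hd Hg x Hx.
  destruct (Req_dec x a) as [-> | Hxa]; [lra | ].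
  destruct (Req_dec x b) as [-> | Hxb]; [lra | ].
  destruct (MVT_cor2 h g a x ltac:(lra)) as [c1 [E1 Hc1]].
  { intros; apply is_derive_Reals, Hd. }
  destruct (MVT_cor2 h g x b ltac:(lra)) as [c2 [E2 Hc2]].
  { intros; apply is_derive_Reals, Hd. }
  specialize (Hg c1 c2 ltac:(lra) ltac:(lra) ltac:(lra)).
  destruct (Rle_lt_dec 0 (h x)) as [ | Hneg]; [easy | ].
  rewrite Ha in E1; rewrite Hb in E2.
  assert (g c1 < 0) by nra; nra.
Qed.

(** By induction: where [bpoly (2k+1)] has constant sign, [bpoly (2k+2)] is
    monotone, so [bpoly (2k+3)] is convex or concave; it vanishes at 0 and at
    1/2, hence has constant sign between them. *)
Lemma bpoly_odd_sign (k : nat) :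
  exists s : R, s * s = 1 /\
    forall x, 0 <= x <= 1 / 2 -> s * bpoly (2 * k + 1) x <= 0.
Proof.
  induction k as [ | k [s [Hs IH]]].
  - exists 1; split; [ring | ]; intros x Hx.
    replace (bpoly (2 * 0 + 1) x) with (x - 1 / 2); [lra | ].
    unfold bpoly; cbn -[bernoulli]; rewrite bernoulli_S; cbn [sum_f_R0].
    rewrite bernoulli_0; unfold Binomial.C; cbn; field.
  - exists (- s); split; [rewrite <- Hs; ring | ]; intros x Hx.
    replace (2 * S k + 1)%nat with (S (S (2 * k + 1))) by lia.
    cut (0 <= s * bpoly (S (S (2 * k + 1))) x); [lra | ].
    apply (concave_between_zeros (fun t => s * bpoly (S (S (2 * k + 1))) t)
             (fun t => s * bpoly (S (2 * k + 1)) t) 0 (1 / 2)); [ | | | | easy].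
    + replace (S (S (2 * k + 1))) with (2 * S k + 1)%nat by lia.
      rewrite bpoly_odd_0 by lia; ring.
    + replace (S (S (2 * k + 1))) with (2 * S k + 1)%nat by lia.
      rewrite bpoly_odd_half; ring.
    + intros t; apply is_derive_scal, is_derive_bpoly.
    + intros u v Hu Huv Hv.
      apply (is_derive_nonpos_le (fun t => s * bpoly (S (2 * k + 1)) t)
               (fun t => s * bpoly (2 * k + 1) t)); [easy | | ].
      * intros t _; apply is_derive_scal, is_derive_bpoly.
      * intros t Ht; apply IH; lra.
Qed.

(** On [[0, 1/2]] the polynomial is monotone, hence bounded by its values at the
    two ends, of which the one at 0 is the larger in absolute value; reflection
    covers the other half. *)
Lemma bpoly_even_le (k : nat) (x : R) :
  (1 <= k)%nat -> 0 <= x <= 1 -> Rabs (bpoly (2 * k) x) <= Rabs (bpoly (2 * k) 0).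
Proof.
  intros Hk.
  assert (Hhalf : forall t, 0 <= t <= 1 / 2 ->
    Rabs (bpoly (2 * k) t) <= Rabs (bpoly (2 * k) 0)).
  { intros t Ht.
    pose proof (bpoly_half_le (2 * k) ltac:(lia)) as Hh.
    destruct (bpoly_odd_sign (k - 1)) as [s [Hs Hneg]].
    replace (2 * k)%nat with (S (2 * (k - 1) + 1)) in * by lia.
    set (m := (2 * (k - 1) + 1)%nat) in *.
    assert (Hmono : forall u v, 0 <= u -> u <= v -> v <= 1 / 2 ->
      s * bpoly (S m) v <= s * bpoly (S m) u).
    { intros u v Hu Huv Hv.
      apply (is_derive_nonpos_le (fun t => s * bpoly (S m) t)
               (fun t => s * bpoly m t)); [easy | | ].
      - intros w _; apply is_derive_scal, is_derive_bpoly.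
      - intros w Hw; apply Hneg; lra. }
    pose proof (Hmono 0 t ltac:(lra) ltac:(lra) ltac:(lra)) as H1.
    pose proof (Hmono t (1 / 2) ltac:(lra) ltac:(lra) ltac:(lra)) as H2.
    assert (Habs : forall y, Rabs (s * y) = Rabs y).
    { intros y; rewrite Rabs_mult.
      replace (Rabs s) with 1; [ring | ].
      rewrite <- (Rabs_pos_eq 1) by lra.
      apply Rsqr_eq_abs_0; unfold Rsqr; lra. }
    rewrite <- Habs, <- (Habs (bpoly (S m) 0)).
    rewrite <- (Habs (bpoly (S m) (1 / 2))), <- (Habs (bpoly (S m) 0)) in Hh.
    apply Rabs_le.
    pose proof (Rle_abs (s * bpoly (S m) 0)).
    pose proof (Rle_abs (- (s * bpoly (S m) (1 / 2)))).
    rewrite Rabs_Ropp in *; lra. }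
  intros Hx; destruct (Rle_lt_dec x (1 / 2)) as [H | H].
  - apply Hhalf; lra.
  - replace x with (1 - (1 - x)) by ring.
    rewrite bpoly_reflection, pow_1_even, Rmult_1_l; apply Hhalf; lra.
Qed.

(** * One step of the Euler-Maclaurin formula *)

(** Stirling's approximation with [k] correction terms: [stirling_remainder L (k + 1) z]
    is [L z - stirling_sum k z]. *)
Definition stirling_sum (k : nat) (z : C) : C :=
  ((z - 1 / 2) * Clog z - z + 1 / 2 * ln (2 * PI)
   + sum_n_m (fun j => T j z) 1 k)%C.

Lemma stirling_sum_S (k : nat) (z : C) :
  stirling_sum (S k) z = (stirling_sum k z + T (S k) z)%C.
Proof.
  unfold stirling_sum; rewrite sum_n_Sm by lia.
  unfold plus; cbn -[T]; ring.
Qed.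

(** A primitive of [Clog (z + u)] minus the boundary terms of [m + 1] integrations
    by parts against the Bernoulli polynomials. In its derivative all terms cancel
    but the last one. *)
Fixpoint em_prim (m : nat) (z : C) (u : R) : C :=
  match m with
  | O => ((z + u) * Clog (z + u) - (z + u) - bpoly 1 u * Clog (z + u))%C
  | S p => (em_prim p z u + (INR (fact p) * bpoly (S (S p)) u) * (/ (z + u)) ^ S p)%C
  end.

Lemma is_Cderive_shift_inv_pow (z : C) (u : R) (m : nat) :
  (z + u)%C <> RtoC 0 ->
  is_Cderive (fun t => (/ (z + RtoC t)) ^ m)%C u
    (- (INR m * (/ (z + u)) ^ S m))%C.
Proof.
  intros Hz; induction m as [ | m IH].
  - apply is_Cderive_ext with (fun t => RtoC 1); [easy | ].
    replace (- (INR 0 * (/ (z + u)) ^ 1))%C with (RtoC 0) by (cbn [INR]; ring).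
    exact (is_Cderive_real (fun _ => 1) u 0 (is_derive_const _ _)).
  - apply is_Cderive_ext with (fun t => / (z + RtoC t) * (/ (z + RtoC t)) ^ m)%C.
    { easy. }
    assert (Hi : is_Cderive (fun t => / (z + RtoC t))%C u
                   (- (RtoC 1 * (/ (z + u) * / (z + u))))%C).
    { apply is_Cderive_inv; [easy | ].
      apply is_Cderive_ext with (fun t => z + RtoC t * RtoC 1)%C.
      - intros t; now rewrite Cmult_1_r.
      - apply is_Cderive_line. }
    pose proof (is_Cderive_mult _ _ _ _ _ Hi IH) as H.
    replace (- (INR (S m) * (/ (z + u)) ^ S (S m)))%C with
      (- (RtoC 1 * (/ (z + u) * / (z + u))) * (/ (z + u)) ^ m
       + / (z + u) * - (INR m * (/ (z + u)) ^ S m))%C; [exact H | ].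
    rewrite S_INR, RtoC_plus; cbn [Cpow]; ring.
Qed.

Lemma is_Cderive_em_prim (m : nat) (z : C) (u : R) :
  slit_plane (z + u)%C ->
  is_Cderive (em_prim m z) u
    (- (INR (fact m) * bpoly (S m) u * (/ (z + u)) ^ S m))%C.
Proof.
  intros Hs.
  assert (H0 : (z + u)%C <> RtoC 0) by (intros E; apply Hs; rewrite E; cbn; lra).
  induction m as [ | m IH].
  - assert (Hid : is_Cderive (fun t => z + RtoC t)%C u (RtoC 1)).
    { apply is_Cderive_ext with (fun t => z + RtoC t * RtoC 1)%C.
      - intros t; now rewrite Cmult_1_r.
      - apply is_Cderive_line. }
    pose proof (is_Cderive_Clog_shift z u Hs) as Hlog.
    pose proof (is_Cderive_real (bpoly 1) u _ (is_derive_bpoly 0 u)) as Hb.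
    rewrite bpoly_0_l in Hb.
    pose proof (is_Cderive_minus _ _ _ _ _
      (is_Cderive_minus _ _ _ _ _ (is_Cderive_mult _ _ _ _ _ Hid Hlog) Hid)
      (is_Cderive_mult _ _ _ _ _ Hb Hlog)) as H.
    match type of H with is_Cderive _ _ ?l =>
      replace (- (INR (fact 0) * bpoly 1 u * (/ (z + u)) ^ 1))%C with l end.
    + exact H.
    + cbn [fact INR Cpow]; field; easy.
  - pose proof (is_Cderive_real (fun t => INR (fact m) * bpoly (S (S m)) t) u _
      (is_derive_scal _ _ (INR (fact m)) _ (is_derive_bpoly (S m) u))) as Hb.
    pose proof (is_Cderive_plus _ _ _ _ _ IH
      (is_Cderive_mult _ _ _ _ _ Hb (is_Cderive_shift_inv_pow z u (S m) H0))) as H.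
    match type of H with is_Cderive _ _ ?l =>
      replace (- (INR (fact (S m)) * bpoly (S (S m)) u * (/ (z + u)) ^ S (S m)))%C
        with l end.
    + refine (is_Cderive_ext _ _ _ _ _ H).
      intros t; cbn [em_prim]; now rewrite RtoC_mult.
    + change (fact (S m)) with (S m * fact m)%nat.
      rewrite mult_INR, !RtoC_mult; ring.
Qed.

Lemma T_S (k : nat) (z : C) :
  z <> RtoC 0 ->
  T (S k) z = (INR (fact (2 * k)) * bpoly (S (S (2 * k))) 0 * (/ z) ^ S (2 * k))%C.
Proof.
  intros Hz; unfold T; rewrite bpoly_at_0.
  replace (2 * S k)%nat with (S (S (2 * k))) by lia.
  set (m := (2 * k)%nat).
  replace (S (S m) - 1)%nat with (S m) by lia.
  rewrite (Cpow_inv z) by easy.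
  assert (Hm := INR_fact_neq_0 m).
  assert (H1 : INR (S m) <> 0) by (apply not_0_INR; lia).
  assert (H2 : INR (S (S m)) <> 0) by (apply not_0_INR; lia).
  rewrite <- RtoC_mult.
  change (fact (S (S m))) with (S (S m) * (S m * fact m))%nat; rewrite !mult_INR.
  replace (INR (fact m) * (bernoulli (S (S m)) / (INR (S (S m)) * (INR (S m) * INR (fact m)))))
    with (bernoulli (S (S m)) / (INR (S (S m)) * INR (S m))) by (field; easy).
  assert (H3 : INR (S (S m)) * INR (S m) <> 0) by (apply Rmult_integral_contrapositive; easy).
  rewrite RtoC_div by easy.
  field; split; [now apply Cpow_nz | ].
  intros E; apply H3; now apply RtoC_inj.
Qed.

(** Only the boundary terms of even index survive: the odd Bernoulli numbers
    vanish. The terms of index at most 1 give the logarithmic part of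
    [stirling_sum] and the summand [Clog z]. *)
Lemma em_prim_increment (k : nat) (z : C) :
  z <> RtoC 0 -> (z + 1)%C <> RtoC 0 ->
  (em_prim (2 * k) z 1 - em_prim (2 * k) z 0)%C =
  (stirling_sum k (z + 1) - stirling_sum k z - Clog z)%C.
Proof.
  intros Hz Hz1; induction k as [ | k IH].
  - change (2 * 0)%nat with 0%nat; cbn [em_prim]; unfold stirling_sum; rewrite !sum_n_m_zero by lia.
    assert (H1 : bpoly 1 1 = 1 / 2).
    { unfold bpoly; cbn -[bernoulli]; rewrite bernoulli_S; cbn [sum_f_R0].
      rewrite bernoulli_0; unfold Binomial.C; cbn; field. }
    assert (H0 : bpoly 1 0 = - (1 / 2)).
    { pose proof (bpoly_reflection 1 1) as H; rewrite Rminus_diag in H.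
      rewrite H, H1; ring. }
    rewrite H1, H0, RtoC_opp, RtoC_div, Cplus_0_r by lra.
    change (@zero C_AbelianMonoid) with (RtoC 0).
    field; intros E; apply RtoC_inj in E; lra.
  - rewrite !stirling_sum_S, !T_S by easy.
    replace (2 * S k)%nat with (S (S (2 * k))) by lia.
    cbn [em_prim].
    replace (S (S (S (2 * k)))) with (2 * S k + 1)%nat by lia.
    rewrite (bpoly_at_1 (2 * S k + 1)), bpoly_odd_0, Cplus_0_r by lia.
    rewrite (bpoly_at_1 (S (S (2 * k)))) by lia.
    match goal with |- (?x + ?a + ?e - (?y + ?b + ?f))%C = _ =>
      replace (x + a + e - (y + b + f))%C with ((x - y) + a - b)%C by ring end.
    rewrite IH; ring.
Qed.

(** Writing the step as the increment of [em_prim (2k - 1)] rather than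
    [em_prim (2k)] makes the derivative a multiple of the even polynomial
    [bpoly (2k)], which is bounded by its value at 0. The majorant [dg] is left
    free: one serves for the final bound, another for uniform convergence. *)
Lemma stirling_step_le (k : nat) (z : C) (g dg : R -> R) :
  (1 <= k)%nat -> 0 <= Re z -> z <> RtoC 0 ->
  (forall u, 0 <= u <= 1 -> is_derive g u (dg u)) ->
  (forall u, 0 < u < 1 ->
    Rabs (bernoulli (2 * k)) / INR (2 * k) / Cmod (z + u) ^ (2 * k) <= dg u) ->
  Cmod (stirling_sum k (z + 1) - stirling_sum k z - Clog z) <= g 1 - g 0.
Proof.
  intros Hk Hre Hz Hg Hle.
  assert (Hnz : forall u, 0 <= u -> (z + RtoC u)%C <> RtoC 0).
  { intros u Hu; now apply Re_nonneg_shift. }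
  rewrite <- em_prim_increment; [ | easy | apply Hnz; lra].
  replace (em_prim (2 * k) z 1 - em_prim (2 * k) z 0)%C
    with (em_prim (2 * k - 1) z 1 - em_prim (2 * k - 1) z 0)%C.
  2: { replace (2 * k)%nat with (S (2 * k - 1)) at 3 4 by lia; cbn [em_prim].
       replace (S (S (2 * k - 1))) with (2 * k + 1)%nat by lia.
       rewrite bpoly_at_1, bpoly_odd_0 by lia; ring. }
  eapply Cmod_increment_le; [lra | | exact Hg | ].
  - intros u Hu; apply is_Cderive_em_prim, slit_plane_Re_nonneg.
    + unfold Re in *; cbn; lra.
    + apply Hnz; lra.
  - intros u Hu; eapply Rle_trans; [ | apply Hle, Hu].
    replace (S (2 * k - 1)) with (2 * k)%nat by lia.
    rewrite Cmod_opp, Cpow_inv, !Cmod_mult, Cmod_inv, Cmod_pow, !Cmod_R.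
    2: { apply Cpow_nz, Hnz; lra. }
    2: { apply Hnz; lra. }
    apply Rmult_le_compat_r.
    { left; apply Rinv_0_lt_compat, pow_lt, Cmod_gt_0, Hnz; lra. }
    pose proof (bpoly_even_le k u Hk ltac:(lra)) as Hb.
    rewrite bpoly_at_0 in Hb.
    rewrite (Rabs_pos_eq (INR _)) by apply pos_INR.
    eapply Rle_trans; [apply Rmult_le_compat_l; [apply pos_INR | exact Hb] | ].
    right; unfold Rdiv; rewrite Rabs_mult, Rabs_inv.
    rewrite (Rabs_pos_eq (INR _)) by apply pos_INR.
    replace (fact (2 * k)) with (2 * k * fact (2 * k - 1))%nat.
    2: { replace (2 * k)%nat with (S (2 * k - 1)) at 3 by lia; cbn [fact]; lia. }
    rewrite mult_INR; field; split; [apply not_0_INR; lia | apply INR_fact_neq_0].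
Qed.

(** * Wallis integrals *)

Definition cos_pow_int (n : nat) (x : R) : R := RInt (fun t => cos t ^ n) 0 x.

Definition wallis (n : nat) : R := cos_pow_int n (PI / 2).

Lemma continuous_cos_pow (n : nat) (x : R) : continuous (fun t => cos t ^ n) x.
Proof. apply (ex_derive_continuous (fun t => cos t ^ n)); auto_derive; easy. Qed.

Lemma ex_RInt_cos_pow (n : nat) (a b : R) : ex_RInt (fun t => cos t ^ n) a b.
Proof.
  apply (ex_RInt_continuous (V := R_CompleteNormedModule)).
  intros; apply continuous_cos_pow.
Qed.

Lemma is_derive_cos_pow_int (n : nat) (x : R) :
  is_derive (cos_pow_int n) x (cos x ^ n).
Proof.
  apply (is_derive_RInt (fun t => cos t ^ n) _ 0).
  - apply filter_forall; intros y.
    apply (RInt_correct (V := R_CompleteNormedModule)), ex_RInt_cos_pow.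
  - apply continuous_cos_pow.
Qed.

Lemma cos_pow_int_le (n : nat) (x : R) :
  0 <= x <= PI / 2 -> cos_pow_int n x <= wallis n.
Proof.
  intros Hx; cut (- wallis n <= - cos_pow_int n x); [lra | ].
  apply (is_derive_nonpos_le (fun t => - cos_pow_int n t) (fun t => - cos t ^ n)).
  - lra.
  - intros t _; exact (is_derive_opp _ _ _ (is_derive_cos_pow_int n t)).
  - intros t Ht; pose proof (pow_le (cos t) n (cos_ge_0 t ltac:(lra) ltac:(lra))); lra.
Qed.

(** The derivative of [sin * cos^(n+1)] is [(n+2) cos^(n+2) - (n+1) cos^n]. *)
Lemma wallis_recurrence (n : nat) :
  INR (S (S n)) * wallis (S (S n)) = INR (S n) * wallis n.
Proof.
  pose proof PI_RGT_0 as Hpi.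
  assert (H1 : is_RInt (fun t => INR (S (S n)) * cos t ^ S (S n) - INR (S n) * cos t ^ n)
                 0 (PI / 2) (INR (S (S n)) * wallis (S (S n)) - INR (S n) * wallis n)).
  { apply (is_RInt_minus (V := R_NormedModule)); apply (is_RInt_scal (V := R_NormedModule));
      apply (RInt_correct (V := R_CompleteNormedModule)), ex_RInt_cos_pow. }
  assert (H2 : is_RInt (fun t => INR (S (S n)) * cos t ^ S (S n) - INR (S n) * cos t ^ n)
                 0 (PI / 2) (minus (sin (PI / 2) * cos (PI / 2) ^ S n)
                                   (sin 0 * cos 0 ^ S n))).
  { apply (is_RInt_derive (V := R_CompleteNormedModule) (fun t => sin t * cos t ^ S n)).
    - intros t _; auto_derive; [easy | ].
      pose proof (sin2_cos2 t) as Hsc; unfold Rsqr in Hsc.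
      change (match n with O => 1 | S _ => INR n + 1 end) with (INR (S n)).
      rewrite (S_INR (S n)); cbn [pow pred].
      replace (sin t * (1 * - sin t * (INR (S n) * cos t ^ n)))
        with (- INR (S n) * (sin t * sin t) * cos t ^ n) by ring.
      replace (sin t * sin t) with (1 - cos t * cos t) by lra; ring.
    - intros t _; apply (ex_derive_continuous (V := R_NormedModule)); auto_derive; easy. }
  pose proof (is_RInt_unique _ _ _ _ H1) as E; rewrite (is_RInt_unique _ _ _ _ H2) in E.
  rewrite sin_0, cos_PI2, pow_ne_zero in E by lia.
  unfold minus, plus, opp in E; cbn -[INR wallis] in E; lra.
Qed.

Lemma wallis_0 : wallis 0 = PI / 2.
Proof.
  unfold wallis, cos_pow_int; cbn [pow]; rewrite RInt_const.
  unfold scal; cbn; unfold mult; cbn; ring.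
Qed.

Lemma wallis_1 : wallis 1 = 1.
Proof.
  unfold wallis, cos_pow_int.
  assert (H : is_RInt (fun t => cos t ^ 1) 0 (PI / 2) (minus (sin (PI / 2)) (sin 0))).
  { apply (is_RInt_derive (V := R_CompleteNormedModule) sin).
    - intros t _; auto_derive; [easy | ring].
    - intros t _; apply continuous_cos_pow. }
  rewrite (is_RInt_unique _ _ _ _ H), sin_PI2, sin_0.
  unfold minus, plus, opp; cbn; ring.
Qed.

Lemma wallis_product (n : nat) : INR (S n) * wallis n * wallis (S n) = PI / 2.
Proof.
  induction n as [ | n IH].
  - rewrite wallis_0, wallis_1; cbn; field.
  - rewrite <- IH.
    replace (INR (S (S n)) * wallis (S n) * wallis (S (S n)))
      with (INR (S (S n)) * wallis (S (S n)) * wallis (S n)) by ring.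
    rewrite wallis_recurrence; ring.
Qed.

Lemma wallis_decr (n : nat) : wallis (S n) < wallis n.
Proof.
  pose proof PI_RGT_0 as Hpi.
  unfold wallis, cos_pow_int; apply RInt_lt; [lra | | | ].
  - intros; apply continuous_cos_pow.
  - intros; apply continuous_cos_pow.
  - intros t Ht; cbn [pow].
    assert (Hc : 0 < cos t) by (apply cos_gt_0; lra).
    assert (Hc1 : cos t < 1).
    { rewrite <- cos_0; apply cos_decreasing_1; lra. }
    pose proof (pow_lt _ n Hc); nra.
Qed.

Lemma wallis_pos (n : nat) : 0 < wallis n.
Proof.
  eapply Rle_lt_trans; [ | apply wallis_decr].
  pose proof PI_RGT_0 as Hpi.
  apply RInt_ge_0; [lra | apply ex_RInt_cos_pow | ].
  intros t Ht; apply pow_le, cos_ge_0; lra.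
Qed.

(** The square of [wallis (2k)] is less than
    [wallis (2k) * wallis (2k - 1) = PI / (4k)]. *)
Lemma wallis_even_lt (k : nat) :
  (1 <= k)%nat -> INR (2 * k) * wallis (2 * k) < sqrt (PI * INR k).
Proof.
  intros Hk; pose proof PI_RGT_0 as Hpi.
  assert (HK : 0 < INR k) by (apply lt_0_INR; lia).
  pose proof (wallis_product (2 * k - 1)) as Hp.
  pose proof (wallis_decr (2 * k - 1)) as Hd.
  replace (S (2 * k - 1)) with (2 * k)%nat in * by lia.
  pose proof (wallis_pos (2 * k)) as Hpos.
  assert (E2 : INR (2 * k) = 2 * INR k) by (rewrite mult_INR; cbn; ring).
  rewrite E2 in *.
  set (w := wallis (2 * k)) in *; set (v := wallis (2 * k - 1)) in *.
  apply Rsqr_incrst_0; [ | nra | apply sqrt_pos].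
  rewrite Rsqr_sqrt by nra; unfold Rsqr.
  replace (PI * INR k) with (2 * INR k * (2 * INR k * v * w)) by (rewrite Hp; field).
  assert (0 < 2 * INR k * (2 * INR k) * w * (v - w)); [ | nra].
  repeat apply Rmult_lt_0_compat; lra.
Qed.

(** The integral from 0 to [u] of [(r^2 + t^2)^-(m+1)], after the substitution
    [t = r tan x]. *)
Definition inv_pow_int (r : R) (m : nat) (u : R) : R :=
  cos_pow_int (2 * m) (atan (u / r)) / r ^ (2 * m + 1).

Lemma is_derive_inv_pow_int (r : R) (m : nat) (u : R) :
  0 < r -> is_derive (inv_pow_int r m) u (/ (r * r + u * u) ^ S m).
Proof.
  intros Hr.
  assert (Ha : is_derive (fun t => atan (t / r)) u (r / (r * r + u * u))).
  { auto_derive; [lra | ].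
    field; split; [nra | lra]. }
  pose proof (is_derive_comp (cos_pow_int (2 * m)) (fun t => atan (t / r)) u _ _
    (is_derive_cos_pow_int (2 * m) (atan (u / r))) Ha) as H.
  pose proof (is_derive_scal _ _ (/ r ^ (2 * m + 1)) _ H) as H'.
  apply (is_derive_ext
    (fun t => / r ^ (2 * m + 1) * cos_pow_int (2 * m) (atan (t / r)))).
  { intros t; unfold inv_pow_int; apply Rmult_comm. }
  evar_last; [exact H' | ].
  unfold scal; cbn -[pow Nat.mul]; unfold mult; cbn -[pow Nat.mul].
  set (s := r * r + u * u); assert (Hs : 0 < s) by (unfold s; nra).
  assert (Hcos : cos (atan (u / r)) ^ 2 = r * r / s).
  { rewrite cos_atan.
    assert (H1 : 0 < 1 + (u / r)²) by (pose proof (Rle_0_sqr (u / r)); lra).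
    pose proof (sqrt_lt_R0 _ H1) as Hq.
    replace ((1 / sqrt (1 + (u / r)²)) ^ 2)
      with (/ (sqrt (1 + (u / r)²) * sqrt (1 + (u / r)²))) by (field; lra).
    rewrite sqrt_sqrt by lra; unfold s, Rsqr; field.
    split; nra. }
  rewrite pow_mult, Hcos; unfold Rdiv; rewrite Rpow_mult_distr, pow_inv.
  rewrite pow_add, pow_mult; cbn [pow]; rewrite !Rmult_1_r.
  rewrite Rpow_mult_distr; field.
  assert (Hrm := pow_lt r m Hr); assert (Hsm := pow_lt s m Hs).
  repeat split; lra.
Qed.

(** * The constant in Stirling's formula *)

(** Two bounds accurate enough to control [(n + 1/2) ln (1 + 1/n) - 1]: the lower
    one makes it nonnegative, the upper one makes it summable. *)
Lemma ln_1p_bounds (x : R) :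
  0 <= x -> 2 * x / (2 + x) <= ln (1 + x) <= x - x ^ 2 / 2 + x ^ 3 / 3.
Proof.
  intros Hx; split.
  - pose proof (is_derive_nonpos_le (fun t => 2 * t / (2 + t) - ln (1 + t))
      (fun t => 4 / ((2 + t) * (2 + t)) - 1 / (1 + t)) 0 x Hx) as H.
    cbn beta in H.
    replace (2 * 0 / (2 + 0) - ln (1 + 0)) with 0 in H.
    2: { rewrite !Rplus_0_r, ln_1; field; lra. }
    enough (2 * x / (2 + x) - ln (1 + x) <= 0) by lra.
    apply H.
    + intros t Ht; auto_derive; [repeat split; lra | field; lra].
    + intros t Ht.
      replace (4 / ((2 + t) * (2 + t)) - 1 / (1 + t))
        with (- (t * t / ((2 + t) * (2 + t) * (1 + t)))) by (field; lra).
      enough (0 <= t * t / ((2 + t) * (2 + t) * (1 + t))) by lra.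
      apply Rdiv_le_0_compat; [nra | ].
      repeat apply Rmult_lt_0_compat; lra.
  - pose proof (is_derive_nonpos_le (fun t => ln (1 + t) - (t - t ^ 2 / 2 + t ^ 3 / 3))
      (fun t => 1 / (1 + t) - (1 - t + t ^ 2)) 0 x Hx) as H.
    cbn beta in H.
    replace (ln (1 + 0) - (0 - 0 ^ 2 / 2 + 0 ^ 3 / 3)) with 0 in H.
    2: { rewrite Rplus_0_r, ln_1; field. }
    enough (ln (1 + x) - (x - x ^ 2 / 2 + x ^ 3 / 3) <= 0) by lra.
    apply H.
    + intros t Ht; auto_derive; [repeat split; lra | field; lra].
    + intros t Ht.
      replace (1 / (1 + t) - (1 - t + t ^ 2)) with (- (t ^ 3 / (1 + t))) by (field; lra).
      enough (0 <= t ^ 3 / (1 + t)) by lra.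
      apply Rdiv_le_0_compat; [apply pow_le | ]; lra.
Qed.

Definition stirling_defect (n : nat) : R :=
  ln (INR (fact n)) - (INR n + 1 / 2) * ln (INR n) + INR n.

(** The upper bound telescopes, so the decreasing sequence [stirling_defect] is
    bounded below. *)
Lemma stirling_defect_step (n : nat) :
  (1 <= n)%nat ->
  0 <= stirling_defect n - stirling_defect (S n) <= (/ INR n - / INR (S n)) / 2.
Proof.
  intros Hn; unfold stirling_defect.
  change (fact (S n)) with (S n * fact n)%nat; rewrite mult_INR.
  assert (H1 : 1 <= INR n) by (apply (le_INR 1); easy).
  rewrite ln_mult by (try apply lt_0_INR; try apply lt_O_fact; lia).
  rewrite S_INR; set (N := INR n) in *; set (x := / N).
  assert (Hx : 0 < x <= 1).
  { unfold x; split; [apply Rinv_0_lt_compat; lra | ].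
    rewrite <- Rinv_1; apply Rinv_le_contravar; lra. }
  assert (EL : ln (N + 1) = ln N + ln (1 + x)).
  { rewrite <- ln_mult by lra; f_equal; unfold x; field; lra. }
  rewrite EL.
  pose proof (ln_1p_bounds x ltac:(lra)) as [Hlo Hhi].
  assert (HN : N = / x) by (unfold x; now rewrite Rinv_inv).
  match goal with |- 0 <= ?e /\ _ =>
    replace e with ((N + 1 / 2) * ln (1 + x) - 1) by ring end.
  assert (Hc : 0 < N + 1 / 2) by lra.
  split.
  - apply (Rmult_le_compat_l _ _ _ (Rlt_le _ _ Hc)) in Hlo.
    replace ((N + 1 / 2) * (2 * x / (2 + x))) with 1 in Hlo; [lra | ].
    rewrite HN; field; lra.
  - apply (Rmult_le_compat_l _ _ _ (Rlt_le _ _ Hc)) in Hhi.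
    replace ((N + 1 / 2) * (x - x ^ 2 / 2 + x ^ 3 / 3))
      with (1 + x ^ 2 / 12 + x ^ 3 / 6) in Hhi by (rewrite HN; field; lra).
    assert (x ^ 2 / 4 <= (x - / (N + 1)) / 2).
    { replace (x - / (N + 1)) with (x ^ 2 / (1 + x)) by (rewrite HN; field; lra).
      assert (x ^ 2 / 2 <= x ^ 2 / (1 + x)); [ | lra].
      apply Rmult_le_compat_l; [nra | ]; apply Rinv_le_contravar; lra. }
    assert (x ^ 3 <= x ^ 2) by (cbn; nra); lra.
Qed.

Lemma ex_lim_stirling_defect : ex_finite_lim_seq stirling_defect.
Proof.
  enough (H : ex_finite_lim_seq (fun n => stirling_defect (S n))).
  { destruct H as [l Hl]; exists l; now apply is_lim_seq_incr_1. }
  apply ex_finite_lim_seq_decr with (stirling_defect 1 - 1 / 2).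
  - intros n; pose proof (stirling_defect_step (S n) ltac:(lia)); lra.
  - intros n.
    assert (H : stirling_defect 1 - 1 / 2 + / INR (S n) / 2 <= stirling_defect (S n)).
    { induction n as [ | n IH]; [cbn [INR]; lra | ].
      pose proof (stirling_defect_step (S n) ltac:(lia)); lra. }
    assert (0 < / INR (S n)) by (apply Rinv_0_lt_compat, lt_0_INR; lia); lra.
Qed.

Lemma wallis_even_factorial (n : nat) :
  wallis (2 * n) * (INR (fact n) * INR (fact n) * 4 ^ n) = PI / 2 * INR (fact (2 * n)).
Proof.
  induction n as [ | n IH].
  - change (2 * 0)%nat with 0%nat; rewrite wallis_0; cbn; ring.
  - replace (2 * S n)%nat with (S (S (2 * n))) by lia.
    pose proof (wallis_recurrence (2 * n)) as Hw.
    change (fact (S (S (2 * n)))) with (S (S (2 * n)) * (S (2 * n) * fact (2 * n)))%nat.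
    change (fact (S n)) with (S n * fact n)%nat.
    rewrite !mult_INR.
    transitivity (INR (S (S (2 * n))) * INR (S (2 * n)) * (PI / 2 * INR (fact (2 * n)))).
    2: ring.
    rewrite <- IH.
    transitivity (INR (S (S (2 * n))) * wallis (S (S (2 * n))) * INR (S (S (2 * n)))
                  * (INR (fact n) * INR (fact n) * 4 ^ n)).
    + assert (E : INR (S (S (2 * n))) = 2 * INR (S n)).
      { replace (S (S (2 * n))) with (2 * S n)%nat by lia; now rewrite mult_INR. }
      rewrite E; cbn [pow]; ring.
    + rewrite Hw; ring.
Qed.

(** The left-hand side has the limit [l - 2 l = - l] if the defect tends to [l],
    while the right-hand side is governed by the Wallis product: this identifies
    [l]. *)
Lemma stirling_defect_double (n : nat) :
  (1 <= n)%nat ->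
  stirling_defect (2 * n) - 2 * stirling_defect n =
  1 / 2 * ln (INR n * (wallis (2 * n) * wallis (2 * n))) + ln (2 / PI) - 1 / 2 * ln 2.
Proof.
  intros Hn; pose proof PI_RGT_0 as Hpi.
  assert (HN : 0 < INR n) by (apply lt_0_INR; lia).
  pose proof (wallis_pos (2 * n)) as Hw.
  pose proof (lt_0_INR _ (lt_O_fact n)) as Hf.
  assert (H4 : 0 < 4 ^ n) by (apply pow_lt; lra).
  assert (Hq : 0 < 2 / PI) by (apply Rdiv_lt_0_compat; lra).
  assert (E : ln (INR (fact (2 * n))) =
    ln (2 / PI) + (ln (wallis (2 * n)) + (ln (INR (fact n)) + ln (INR (fact n))
      + INR n * ln 4))).
  { rewrite <- ln_pow, <- !ln_mult by (repeat apply Rmult_lt_0_compat; lra).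
    f_equal; rewrite wallis_even_factorial; field; lra. }
  unfold stirling_defect; rewrite E.
  rewrite !ln_mult by (try apply Rmult_lt_0_compat; lra).
  rewrite mult_INR; change (INR 2) with 2.
  rewrite ln_mult by lra.
  replace 4 with (2 * 2) by ring; rewrite ln_mult by lra.
  field; lra.
Qed.

(** The square of [wallis (2n)] lies between its products with the two
    neighbouring Wallis integrals, which [wallis_product] evaluates. *)
Lemma is_lim_seq_wallis_sqr :
  is_lim_seq (fun n => INR (S n) * (wallis (2 * S n) * wallis (2 * S n))) (PI / 4).
Proof.
  pose proof PI_RGT_0 as Hpi.
  apply is_lim_seq_le_le with (fun n => PI / 4 - PI / 8 * / INR (S n)) (fun _ => PI / 4).
  - intros n.
    pose proof (lt_0_INR (S n) ltac:(lia)) as HN.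
    pose proof (wallis_product (2 * S n)) as H1.
    pose proof (wallis_decr (2 * S n)) as H2.
    pose proof (wallis_product (2 * S n - 1)) as H3.
    pose proof (wallis_decr (2 * S n - 1)) as H4.
    replace (S (2 * S n - 1)) with (2 * S n)%nat in * by lia.
    rewrite S_INR in H1.
    assert (E : INR (2 * S n) = 2 * INR (S n)) by (rewrite mult_INR; easy).
    rewrite E in *.
    pose proof (wallis_pos (2 * S n)) as Hw.
    set (N := INR (S n)) in *; set (w := wallis (2 * S n)) in *.
    split.
    + assert (H : PI / 2 <= (2 * N + 1) * w * w).
      { rewrite <- H1; apply Rmult_le_compat_l; [nra | lra]. }
      apply (Rmult_le_reg_l (2 * (2 * N + 1))); [lra | ].
      apply Rle_trans with (N * PI).
      2: nra.
      replace (2 * (2 * N + 1) * (PI / 4 - PI / 8 * / N))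
        with (N * PI - PI / 4 * / N) by (field; lra).
      assert (0 <= PI / 4 * / N); [ | lra].
      apply Rmult_le_pos; [lra | ]; left; apply Rinv_0_lt_compat; lra.
    + assert (H : 2 * N * w * w <= PI / 2); [ | lra].
      rewrite <- H3; apply Rmult_le_compat_r; [lra | ]; apply Rmult_le_compat_l; lra.
  - replace (Finite (PI / 4)) with (Finite (PI / 4 - PI / 8 * 0)) by (f_equal; ring).
    apply is_lim_seq_minus'; [apply is_lim_seq_const | ].
    apply (is_lim_seq_scal_l _ (PI / 8) 0).
    apply (is_lim_seq_incr_1 (fun n => / INR n)).
    apply (is_lim_seq_inv _ p_infty); [apply is_lim_seq_INR | easy].
  - apply is_lim_seq_const.
Qed.

Lemma is_lim_seq_stirling_defect :
  is_lim_seq stirling_defect (1 / 2 * ln (2 * PI)).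
Proof.
  pose proof PI_RGT_0 as Hpi.
  destruct ex_lim_stirling_defect as [l Hl].
  assert (H1 : is_lim_seq
    (fun n => stirling_defect (2 * S n) - 2 * stirling_defect (S n)) (l - 2 * l)).
  { apply is_lim_seq_minus'.
    - apply (is_lim_seq_subseq stirling_defect l (fun n => (2 * S n)%nat)); [ | easy].
      apply eventually_subseq; lia.
    - apply (is_lim_seq_scal_l _ 2 l), (is_lim_seq_incr_1 stirling_defect), Hl. }
  assert (H2 : is_lim_seq
    (fun n => stirling_defect (2 * S n) - 2 * stirling_defect (S n))
    (1 / 2 * ln (PI / 4) + ln (2 / PI) - 1 / 2 * ln 2)).
  { apply is_lim_seq_ext with (fun n =>
      1 / 2 * ln (INR (S n) * (wallis (2 * S n) * wallis (2 * S n)))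
      + ln (2 / PI) - 1 / 2 * ln 2).
    { intros n; now rewrite stirling_defect_double by lia. }
    apply is_lim_seq_minus'; [ | apply is_lim_seq_const].
    apply is_lim_seq_plus'; [ | apply is_lim_seq_const].
    apply (is_lim_seq_scal_l _ (1 / 2) (ln (PI / 4))).
    apply (is_lim_seq_continuous ln _ (PI / 4)); [ | apply is_lim_seq_wallis_sqr].
    apply derivable_continuous_pt; exists (/ (PI / 4)).
    apply derivable_pt_lim_ln; lra. }
  apply is_lim_seq_unique in H1; apply is_lim_seq_unique in H2.
  rewrite H1 in H2; injection H2 as E.
  replace (1 / 2 * ln (2 * PI)) with l; [exact Hl | ].
  rewrite ln_mult by lra; rewrite !ln_div in E by lra.
  replace 4 with (2 * 2) in E by ring; rewrite ln_mult in E by lra; lra.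
Qed.

(** * Gamma as a limit of exponentials *)

Lemma Cexp_plus (a b : C) : Cexp (a + b) = (Cexp a * Cexp b)%C.
Proof.
  destruct a as [a1 a2], b as [b1 b2]; unfold Cexp, Re, Im; cbn.
  rewrite exp_plus, cos_plus, sin_plus; apply injective_projections; cbn; ring.
Qed.

Lemma Cexp_real (x : R) : Cexp (RtoC x) = RtoC (exp x).
Proof.
  unfold Cexp, RtoC, Re, Im; cbn; rewrite cos_0, sin_0.
  apply injective_projections; cbn; ring.
Qed.

Lemma Cexp_minus (a b : C) : Cexp (a - b) = (Cexp a / Cexp b)%C.
Proof.
  assert (H : (Cexp (a - b) * Cexp b)%C = Cexp a).
  { rewrite <- Cexp_plus; f_equal; ring. }
  assert (Hb : Cexp b <> RtoC 0).
  { intros E; assert (E1 : (Cexp b * Cexp (- b))%C = RtoC 1).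
    { rewrite <- Cexp_plus, Cplus_opp_r, Cexp_real, exp_0; easy. }
    rewrite E, Cmult_0_l in E1; apply RtoC_inj in E1; lra. }
  rewrite <- H; field; easy.
Qed.

Lemma Cmod_Cexp (z : C) : Cmod (Cexp z) = exp (Re z).
Proof.
  unfold Cexp, Cmod; cbn [fst snd].
  replace ((exp (Re z) * cos (Im z)) ^ 2 + (exp (Re z) * sin (Im z)) ^ 2)
    with (Rsqr (exp (Re z))).
  - apply sqrt_Rsqr; left; apply exp_pos.
  - pose proof (sin2_cos2 (Im z)) as H; unfold Rsqr in *.
    replace ((exp (Re z) * cos (Im z)) ^ 2 + (exp (Re z) * sin (Im z)) ^ 2)
      with (exp (Re z) * exp (Re z) * (sin (Im z) * sin (Im z) + cos (Im z) * cos (Im z)))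
      by ring.
    rewrite H; ring.
Qed.

Lemma Cexp_eq_inv (a b : C) :
  Cexp a = Cexp b -> Re a = Re b /\ exists m : Z, Im a = Im b + 2 * PI * IZR m.
Proof.
  intros H.
  assert (HR : Re a = Re b).
  { apply exp_inv; rewrite <- !Cmod_Cexp; now rewrite H. }
  split; [easy | ].
  apply (f_equal fst) in H as H1; apply (f_equal snd) in H as H2.
  unfold Cexp in H1, H2; cbn [fst snd] in H1, H2; rewrite HR in H1, H2.
  pose proof (exp_pos (Re b)) as He.
  apply Rmult_eq_reg_l in H1; [ | lra]; apply Rmult_eq_reg_l in H2; [ | lra].
  set (x := Im a) in *; set (y := Im b) in *.
  pose proof (sin2_cos2 y) as Hsc; unfold Rsqr in Hsc.
  (* [sin ((x - y) / 2)] vanishes because [cos (x - y) = 1]. *)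
  assert (Hs : sin ((x - y) / 2) = 0).
  { assert (Hc : cos (2 * ((x - y) / 2)) = 1).
    { replace (2 * ((x - y) / 2)) with (x - y) by field.
      rewrite cos_minus, H1, H2; lra. }
    rewrite cos_2a_sin in Hc.
    assert (E : sin ((x - y) / 2) * sin ((x - y) / 2) = 0) by lra.
    now destruct (Rmult_integral _ _ E). }
  apply sin_eq_0_0 in Hs; destruct Hs as [m Hm].
  exists m; lra.
Qed.

Definition is_lim_Cseq (u : nat -> C) (l : C) : Prop :=
  is_lim_seq (fun n => Re (u n)) (Re l) /\ is_lim_seq (fun n => Im (u n)) (Im l).

Lemma Cmod_le_abs (z : C) : Cmod z <= Rabs (Re z) + Rabs (Im z).
Proof.
  pose proof (Rabs_pos (Re z)); pose proof (Rabs_pos (Im z)).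
  apply Rsqr_incr_0; [ | apply Cmod_ge_0 | lra].
  unfold Rsqr; rewrite Cmod_sqr.
  replace (Re z * Re z) with (Rabs (Re z) * Rabs (Re z)).
  - replace (Im z * Im z) with (Rabs (Im z) * Rabs (Im z)); [nra | ].
    rewrite <- Rabs_mult; apply Rabs_pos_eq; nra.
  - rewrite <- Rabs_mult; apply Rabs_pos_eq; nra.
Qed.

Lemma Im_le_Cmod (z : C) : Rabs (Im z) <= Cmod z.
Proof. eapply Rle_trans; [apply Rmax_r | apply Rmax_Cmod]. Qed.

Lemma Cmod_lim_le (u : nat -> C) (l a : C) (e : nat -> R) (B : R) :
  is_lim_Cseq u l -> is_lim_seq e 0 ->
  eventually (fun n => Cmod (u n - a) <= B + e n) -> Cmod (l - a) <= B.
Proof.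
  intros [H1 H2] He Hle.
  assert (Habs : forall (v : nat -> R) (c : R), is_lim_seq v c ->
    is_lim_seq (fun n => Rabs (v n - c)) 0).
  { intros v c Hv; rewrite <- Rabs_R0, <- (Rminus_diag c).
    apply (is_lim_seq_abs _ (Finite (c - c))), is_lim_seq_minus'; [easy | ].
    apply is_lim_seq_const. }
  assert (Hlim : is_lim_seq (fun n => B + e n + (Rabs (Re (u n) - Re l)
                                      + Rabs (Im (u n) - Im l))) (B + 0 + (0 + 0))).
  { apply is_lim_seq_plus'; [apply is_lim_seq_plus'; [apply is_lim_seq_const | easy] | ].
    apply is_lim_seq_plus'; now apply Habs. }
  replace (B + 0 + (0 + 0)) with B in Hlim by ring.
  refine (is_lim_seq_le_loc (fun _ => Cmod (l - a)) _ (Cmod (l - a)) B _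
            (is_lim_seq_const _) Hlim).
  destruct Hle as [N HN]; exists N; intros n Hn; specialize (HN n Hn).
  replace (l - a)%C with ((u n - a) + - (u n - l))%C by ring.
  eapply Rle_trans; [apply Cmod_triangle | ]; rewrite Cmod_opp.
  pose proof (Cmod_le_abs (u n - l)) as H.
  change (Re (u n - l)) with (Re (u n) - Re l) in H.
  change (Im (u n - l)) with (Im (u n) - Im l) in H; lra.
Qed.

Lemma Cseq_cauchy_lim (u : nat -> C) :
  (forall eps : posreal, exists N, forall n m, (N <= n)%nat -> (N <= m)%nat ->
     Cmod (u n - u m) < eps) ->
  exists l, is_lim_Cseq u l.
Proof.
  intros H.
  assert (H1 : ex_finite_lim_seq (fun n => Re (u n))).
  { apply ex_lim_seq_cauchy_corr; intros eps; destruct (H eps) as [N HN].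
    exists N; intros n m Hn Hm; eapply Rle_lt_trans; [ | apply (HN n m Hn Hm)].
    exact (re_le_Cmod (u n - u m)). }
  assert (H2 : ex_finite_lim_seq (fun n => Im (u n))).
  { apply ex_lim_seq_cauchy_corr; intros eps; destruct (H eps) as [N HN].
    exists N; intros n m Hn Hm; eapply Rle_lt_trans; [ | apply (HN n m Hn Hm)].
    exact (Im_le_Cmod (u n - u m)). }
  destruct H1 as [a Ha], H2 as [b Hb]; exists (a, b); easy.
Qed.

Lemma is_lim_Cseq_Cexp (u : nat -> C) (l : C) :
  is_lim_Cseq u l -> is_lim_Cseq (fun n => Cexp (u n)) (Cexp l).
Proof.
  intros [H1 H2].
  assert (He : is_lim_seq (fun n => exp (Re (u n))) (exp (Re l))).
  { apply (is_lim_seq_continuous exp); [ | easy].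
    apply derivable_continuous_pt, derivable_pt_exp. }
  split; cbn; apply is_lim_seq_mult'; try easy.
  - apply (is_lim_seq_continuous cos); [apply continuity_cos | easy].
  - apply (is_lim_seq_continuous sin); [apply continuity_sin | easy].
Qed.

Fixpoint Clog_sum (z : C) (n : nat) : C :=
  match n with
  | O => RtoC 0
  | S m => (Clog_sum z m + Clog (z + INR m))%C
  end.

(** A logarithm of [Gamma_seq z n], continuous in [z]. *)
Definition log_Gamma_seq (z : C) (n : nat) : C :=
  (ln (INR (fact n)) + z * ln (INR n) - Clog_sum z (S n))%C.

Lemma Gamma_seq_exp (z : C) (n : nat) :
  0 <= Re z -> z <> RtoC 0 -> Gamma_seq z n = Cexp (log_Gamma_seq z n).
Proof.
  intros Hre Hz; unfold Gamma_seq, log_Gamma_seq.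
  assert (Hr : forall m, Cexp (Clog_sum z m) = rising z m).
  { induction m as [ | m IH]; cbn [Clog_sum rising].
    - now rewrite Cexp_real, exp_0.
    - destruct (Re_nonneg_shift z (INR m) Hre Hz (pos_INR m)) as [H1 H2].
      rewrite Cexp_plus, IH, Cexp_Clog; [easy | now apply slit_plane_Re_nonneg]. }
  rewrite Cexp_minus, Hr, Cexp_plus, Cexp_real, exp_ln; [easy | ].
  apply lt_0_INR, lt_O_fact.
Qed.

(** The accumulated error of [n] Euler-Maclaurin steps from [z]. In the limit it is
    the difference between the logarithm of Gamma and [stirling_sum k]. *)
Definition em_defect (k : nat) (z : C) (n : nat) : C :=
  (stirling_sum k (z + INR n) - stirling_sum k z - Clog_sum z n)%C.

(** Summation of [stirling_step_le]: the increments of the common majorant [g]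
    telescope. *)
Lemma em_defect_le (k : nat) (z : C) (g dg : R -> R) (m n : nat) :
  (1 <= k)%nat -> 0 <= Re z -> z <> RtoC 0 ->
  (forall u, INR m <= u -> is_derive g u (dg u)) ->
  (forall u, INR m < u ->
    Rabs (bernoulli (2 * k)) / INR (2 * k) / Cmod (z + u) ^ (2 * k) <= dg u) ->
  (m <= n)%nat ->
  Cmod (em_defect k z n - em_defect k z m) <= g (INR n) - g (INR m).
Proof.
  intros Hk Hre Hz Hg Hle Hmn; induction Hmn as [ | n Hmn IH].
  - right; rewrite Rminus_diag; replace (em_defect k z m - em_defect k z m)%C with (RtoC 0) by ring.
    apply Cmod_0.
  - apply le_INR in Hmn.
    destruct (Re_nonneg_shift z (INR n) Hre Hz (pos_INR n)) as [H1 H2].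
    pose proof (stirling_step_le k (z + INR n) (fun u => g (INR n + u))
                  (fun u => dg (INR n + u)) Hk H1 H2) as Hstep.
    cbn beta in Hstep.
    replace (em_defect k z (S n) - em_defect k z m)%C with
      ((stirling_sum k (z + INR n + 1) - stirling_sum k (z + INR n) - Clog (z + INR n))
       + (em_defect k z n - em_defect k z m))%C.
    2: { unfold em_defect; cbn [Clog_sum].
         replace (z + INR (S n))%C with (z + INR n + 1)%C
           by (rewrite S_INR, RtoC_plus; ring).
         ring. }
    eapply Rle_trans; [apply Cmod_triangle | ].
    rewrite S_INR; rewrite Rplus_0_r in Hstep.
    enough (Cmod (stirling_sum k (z + INR n + 1) - stirling_sum k (z + INR n)
                  - Clog (z + INR n)) <= g (INR n + 1) - g (INR n)) by lra.
    apply Hstep.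
    + intros u Hu.
      replace (dg (INR n + u)) with (1 * dg (INR n + u)) by ring.
      apply (is_derive_comp g (fun t => INR n + t)).
      * apply Hg; lra.
      * auto_derive; [easy | ring].
    + intros u Hu.
      replace (z + INR n + u)%C with (z + (INR n + u)%R)%C by (rewrite RtoC_plus; ring).
      apply Hle; lra.
Qed.

Lemma T_le (j : nat) (w : C) (r : R) :
  (1 <= j)%nat -> 1 <= r -> r <= Re w -> Cmod (T j w) <= Rabs (bernoulli (2 * j)) / r.
Proof.
  intros Hj Hr Hw.
  pose proof (Re_le_Cmod w) as Hm.
  assert (Hw0 : w <> RtoC 0) by (apply Re_pos_neq_0; lra).
  assert (Hn : 1 <= INR (2 * j * (2 * j - 1))) by (apply (le_INR 1); nia).
  unfold T; rewrite Cmod_div, Cmod_mult, Cmod_pow, !Cmod_R.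
  2: { apply Cmult_neq_0; [ | now apply Cpow_nz].
       intros E; apply RtoC_inj in E; lra. }
  apply Rmult_le_compat_l; [apply Rabs_pos | ].
  apply Rinv_le_contravar; [lra | ].
  rewrite Rabs_pos_eq by lra.
  assert (Hp : r <= Cmod w ^ (2 * j - 1)).
  { apply Rle_trans with (Cmod w ^ 1); [lra | apply Rle_pow; [lra | lia]]. }
  nra.
Qed.

Lemma T_sum_le (k : nat) :
  exists K, forall (w : C) (r : R), 1 <= r -> r <= Re w ->
    Cmod (sum_n_m (fun j => T j w) 1 k) <= K / r.
Proof.
  induction k as [ | k [K IH]].
  - exists 0; intros w r Hr Hw; rewrite sum_n_m_zero by lia.
    change (@zero C_AbelianMonoid) with (RtoC 0); rewrite Cmod_0; unfold Rdiv; lra.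
  - exists (K + Rabs (bernoulli (2 * S k))); intros w r Hr Hw.
    rewrite sum_n_Sm by lia.
    eapply Rle_trans; [exact (Cmod_triangle _ _) | ].
    specialize (IH w r Hr Hw).
    pose proof (T_le (S k) w r ltac:(lia) Hr Hw).
    unfold Rdiv in *; lra.
Qed.

(** With [n (1 + w) = z + n + 1], the terms in [ln n] cancel, and what is left is
    the defect of the real Stirling formula plus terms of order [1/n]. *)
Lemma log_Gamma_seq_gap (k n : nat) (z : C) :
  (1 <= n)%nat -> 0 <= Re z ->
  let w := ((z + 1) / INR n)%C in
  (log_Gamma_seq z n - stirling_sum k z - em_defect k z (S n))%C =
  ((stirling_defect n - 1 / 2 * ln (2 * PI))%R
   - (z + INR n + 1 / 2) * (Clog (1 + w) - w) - (z + 1 / 2) * w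
   - sum_n_m (fun j => T j (z + INR (S n))%C) 1 k)%C.
Proof.
  intros Hn Hre w.
  assert (HN : 0 < INR n) by (apply lt_0_INR; lia).
  assert (HC : RtoC (INR n) <> RtoC 0) by (intros E; apply RtoC_inj in E; lra).
  assert (Hlog : Clog (z + INR (S n)) = (RtoC (ln (INR n)) + Clog (1 + w))%C).
  { rewrite <- Clog_scal; [ | easy | ].
    - f_equal; unfold w; rewrite S_INR, RtoC_plus; field; easy.
    - intros [_ H]; unfold w in H; revert H.
      replace ((z + 1) / INR n)%C with ((z + 1) * RtoC (/ INR n))%C.
      2: { rewrite RtoC_inv by lra; easy. }
      change (Re (1 + (z + 1) * RtoC (/ INR n)))
        with (1 + Re ((z + 1) * RtoC (/ INR n))).
      rewrite re_scal_r.
      change (Re (z + 1)) with (Re z + 1).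
      assert (0 < / INR n) by now apply Rinv_0_lt_compat.
      nra. }
  unfold log_Gamma_seq, em_defect, stirling_sum at 2, stirling_defect.
  rewrite Hlog.
  rewrite !RtoC_minus, RtoC_plus, RtoC_minus, !RtoC_mult, RtoC_plus, RtoC_div by lra.
  assert (E : (INR n * w)%C = (z + 1)%C) by (unfold w; field; easy).
  replace (RtoC (INR (S n))) with (INR n + 1)%C at 1 2 by (rewrite S_INR, RtoC_plus; easy).
  set (S1 := sum_n_m _ _ _); set (l1 := Clog (1 + w)) in *.
  match goal with |- _ = (?a - _ * (l1 - w) - _ * w - _)%C =>
    transitivity (a - (z + INR n + 1 / 2) * l1 + INR n * w - S1)%C end.
  - rewrite E; field; intros E'; apply RtoC_inj in E'; lra.
  - field; intros E'; apply RtoC_inj in E'; lra.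
Qed.

Lemma log_Gamma_seq_gap_le (k : nat) (M : R) :
  0 <= M ->
  exists e, is_lim_seq e 0 /\
    forall n z, (1 <= n)%nat -> 0 <= Re z -> Cmod z <= M ->
      Cmod (log_Gamma_seq z n - stirling_sum k z - em_defect k z (S n)) <= e n.
Proof.
  intros HM; destruct (T_sum_le k) as [K HK].
  set (c := 1 / 2 * ln (2 * PI)).
  set (A := (M + 2) * ((M + 1) * (M + 1)) / 2 + (M + 1) * (M + 1) + K).
  exists (fun n => Rabs (stirling_defect n - c) + A * / INR n); split.
  - replace (Finite 0) with (Finite (Rabs (c - c) + A * 0)).
    2: { f_equal; rewrite Rminus_diag, Rabs_R0; ring. }
    apply is_lim_seq_plus'.
    + apply (is_lim_seq_abs _ (Finite (c - c))), is_lim_seq_minus'.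
      * apply is_lim_seq_stirling_defect.
      * apply is_lim_seq_const.
    + apply (is_lim_seq_scal_l _ A 0).
      apply (is_lim_seq_inv _ p_infty); [apply is_lim_seq_INR | easy].
  - intros n z Hn Hre Hz.
    rewrite log_Gamma_seq_gap by easy; fold c.
    assert (HN : 1 <= INR n) by (apply (le_INR 1); easy).
    assert (HC : RtoC (INR n) <> RtoC 0) by (intros E; apply RtoC_inj in E; lra).
    set (w := ((z + 1) / INR n)%C).
    assert (H1 : Cmod (RtoC 1) = 1) by (rewrite Cmod_R; apply Rabs_pos_eq; lra).
    assert (Hhalf : Cmod (1 / 2)%C <= 1).
    { rewrite <- RtoC_div, Cmod_R, Rabs_pos_eq by lra; lra. }
    assert (Hw : Cmod w <= (M + 1) * / INR n).
    { unfold w; rewrite Cmod_div, Cmod_R, Rabs_pos_eq by (easy || lra).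
      apply Rmult_le_compat_r; [left; apply Rinv_0_lt_compat; lra | ].
      eapply Rle_trans; [apply Cmod_triangle | lra]. }
    assert (Hwre : 0 <= Re w).
    { unfold w, Cdiv; rewrite <- RtoC_inv by lra; rewrite re_scal_r.
      change (Re (z + 1)) with (Re z + 1).
      apply Rmult_le_pos; [lra | left; apply Rinv_0_lt_compat; lra]. }
    pose proof (Clog_1p_minus_id_le w Hwre) as Hlog.
    specialize (HK (z + INR (S n))%C (INR n) HN).
    assert (Hin : INR n <= Re (z + INR (S n))%C).
    { change (Re (z + INR (S n))) with (Re z + INR (S n)); rewrite S_INR; lra. }
    specialize (HK Hin).
    set (S1 := sum_n_m _ _ _) in *.
    set (d := (Clog (1 + w) - w)%C) in *.
    set (x := / INR n) in *.
    assert (Hx : 0 < x <= 1).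
    { unfold x; split; [apply Rinv_0_lt_compat; lra | ].
      rewrite <- Rinv_1; apply Rinv_le_contravar; lra. }
    assert (HNx : INR n * x = 1) by (unfold x; field; lra).
    unfold Cminus; eapply Rle_trans; [apply Cmod_triangle | ].
    eapply Rle_trans; [apply Rplus_le_compat_r, Cmod_triangle | ].
    eapply Rle_trans; [apply Rplus_le_compat_r, Rplus_le_compat_r, Cmod_triangle | ].
    rewrite !Cmod_opp, !Cmod_mult, Cmod_R.
    assert (Ha : Cmod (z + INR n + 1 / 2) <= (M + 2) * INR n).
    { eapply Rle_trans; [apply Cmod_triangle | ].
      pose proof (Cmod_triangle z (INR n)) as Ht.
      rewrite Cmod_R, Rabs_pos_eq in Ht by lra.
      nra. }
    assert (Hb : Cmod (z + 1 / 2) <= M + 1).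
    { eapply Rle_trans; [apply Cmod_triangle | lra]. }
    pose proof (Cmod_ge_0 w) as Hw0; pose proof (Cmod_ge_0 d) as Hd0.
    assert (P1 : Cmod (z + INR n + 1 / 2) * Cmod d
                 <= (M + 2) * ((M + 1) * (M + 1)) / 2 * x).
    { apply Rle_trans with (((M + 2) * INR n) * (((M + 1) * x) * ((M + 1) * x) / 2)).
      - apply Rmult_le_compat; [apply Cmod_ge_0 | easy | easy | ].
        apply Rle_trans with (1 := Hlog).
        apply Rmult_le_compat_r; [lra | apply Rmult_le_compat; easy].
      - right; transitivity ((M + 2) * ((M + 1) * (M + 1)) / 2 * x * (INR n * x)).
        + field.
        + rewrite HNx; ring. }
    assert (P2 : Cmod (z + 1 / 2) * Cmod w <= (M + 1) * (M + 1) * x).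
    { rewrite Rmult_assoc; apply Rmult_le_compat; try easy; apply Cmod_ge_0. }
    unfold A; unfold Rdiv at 1 in HK; fold x in HK; lra.
Qed.

(** * Uniform convergence and the choice of branch *)

Lemma em_defect_tail_le (z : C) (m n : nat) :
  0 <= Re z -> z <> RtoC 0 -> (1 <= m)%nat -> (m <= n)%nat ->
  Cmod (em_defect 1 z n - em_defect 1 z m) <= Rabs (bernoulli 2) / 2 * / INR m.
Proof.
  intros Hre Hz Hm Hmn.
  set (b := Rabs (bernoulli 2) / 2).
  assert (Hb : 0 <= b) by (unfold b; pose proof (Rabs_pos (bernoulli 2)); lra).
  assert (H1 : 1 <= INR m) by (apply (le_INR 1); easy).
  assert (H2 : INR m <= INR n) by now apply le_INR.
  assert (Hi : 0 <= b * / INR n).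
  { apply Rmult_le_pos; [easy | left; apply Rinv_0_lt_compat; lra]. }
  apply Rle_trans with (- b * / INR n - - b * / INR m); [ | lra].
  apply (em_defect_le 1 z (fun u => - b * / u) (fun u => b * / (u * u)));
    [lia | easy | easy | | | easy].
  - intros u Hu; auto_derive; [lra | field; lra].
  - intros u Hu; change (INR (2 * 1)) with 2; change (2 * 1)%nat with 2%nat.
    apply Rmult_le_compat_l; [easy | ].
    apply Rinv_le_contravar; [nra | ].
    rewrite <- (Rmult_1_r (u * u)) at 1; cbn [pow]; rewrite !Rmult_1_r.
    assert (u <= Cmod (z + u)).
    { eapply Rle_trans; [ | apply Re_le_Cmod].
      change (Re (z + u)) with (Re z + u); lra. }
    nra.
Qed.

(** The tail of [em_defect 1 z] from index 1 on is controlled by [|z + u| >= u],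
    an estimate that stays uniform as [z] approaches 0. *)
Lemma log_Gamma_seq_unif_cauchy (M eps : R) :
  0 <= M -> 0 < eps ->
  exists N, forall z n, 0 <= Re z -> z <> RtoC 0 -> Cmod z <= M -> (N <= n)%nat ->
    Cmod (log_Gamma_seq z n - log_Gamma_seq z N) < eps.
Proof.
  intros HM Heps.
  destruct (log_Gamma_seq_gap_le 1 M HM) as [e [He Hgap]].
  set (b := Rabs (bernoulli 2) / 2).
  assert (Hlim : is_lim_seq (fun n => b * / INR (S n)) 0).
  { replace (Finite 0) with (Finite (b * 0)) by (f_equal; ring).
    apply (is_lim_seq_scal_l _ b 0).
    apply (is_lim_seq_incr_1 (fun n => / INR n)).
    apply (is_lim_seq_inv _ p_infty); [apply is_lim_seq_INR | easy]. }
  apply is_lim_seq_spec in He; apply is_lim_seq_spec in Hlim.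
  assert (Hpos : 0 < eps / 3) by lra.
  destruct (He (mkposreal _ Hpos)) as [N1 HN1].
  destruct (Hlim (mkposreal _ Hpos)) as [N2 HN2].
  cbn [pos] in HN1, HN2.
  pose (N := (N1 + N2 + 1)%nat).
  exists N; intros z n Hre Hz Hmod Hn.
  pose proof (Hgap n z ltac:(lia) Hre Hmod) as G1.
  pose proof (Hgap N z ltac:(lia) Hre Hmod) as G2.
  pose proof (HN1 n ltac:(lia)) as E1; pose proof (HN1 N ltac:(lia)) as E2.
  pose proof (HN2 N ltac:(lia)) as E3.
  rewrite Rminus_0_r in E1, E2, E3.
  pose proof (em_defect_tail_le z (S N) (S n) Hre Hz ltac:(lia) ltac:(lia)) as D.
  fold b in D.
  set (g1 := (log_Gamma_seq z n - stirling_sum 1 z - em_defect 1 z (S n))%C) in *.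
  set (g2 := (log_Gamma_seq z N - stirling_sum 1 z - em_defect 1 z (S N))%C) in *.
  replace (log_Gamma_seq z n - log_Gamma_seq z N)%C
    with (g1 + - g2 + (em_defect 1 z (S n) - em_defect 1 z (S N)))%C
    by (unfold g1, g2; ring).
  eapply Rle_lt_trans; [apply Cmod_triangle | ].
  eapply Rle_lt_trans; [apply Rplus_le_compat_r, Cmod_triangle | ].
  rewrite Cmod_opp.
  pose proof (Rle_abs (e n)); pose proof (Rle_abs (e N)).
  pose proof (Rle_abs (b * / INR (S N))); lra.
Qed.

Lemma Gamma_eq_exp_lim (z : C) :
  0 <= Re z -> z <> RtoC 0 ->
  exists F, is_lim_Cseq (log_Gamma_seq z) F /\ Gamma z = Cexp F.
Proof.
  intros Hre Hz.
  destruct (Cseq_cauchy_lim (log_Gamma_seq z)) as [F HF].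
  { intros eps.
    assert (Hpos : 0 < eps / 2) by (pose proof (cond_pos eps); lra).
    destruct (log_Gamma_seq_unif_cauchy (Cmod z) (eps / 2) (Cmod_ge_0 z) Hpos) as [N HN].
    exists N; intros n m Hn Hm.
    pose proof (HN z n Hre Hz (Rle_refl _) Hn) as H1.
    pose proof (HN z m Hre Hz (Rle_refl _) Hm) as H2.
    replace (log_Gamma_seq z n - log_Gamma_seq z m)%C
      with ((log_Gamma_seq z n - log_Gamma_seq z N)
            + - (log_Gamma_seq z m - log_Gamma_seq z N))%C by ring.
    eapply Rle_lt_trans; [apply Cmod_triangle | rewrite Cmod_opp; lra]. }
  exists F; split; [easy | ].
  destruct (is_lim_Cseq_Cexp _ _ HF) as [H1 H2].
  unfold Gamma.
  rewrite (is_lim_seq_unique (fun n => Re (Gamma_seq z n)) (Re (Cexp F))).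
  2: { apply is_lim_seq_ext with (2 := H1); intros n; now rewrite Gamma_seq_exp. }
  rewrite (is_lim_seq_unique (fun n => Im (Gamma_seq z n)) (Im (Cexp F))).
  2: { apply is_lim_seq_ext with (2 := H2); intros n; now rewrite Gamma_seq_exp. }
  now destruct (Cexp F).
Qed.

Lemma Im_log_Gamma_seq_real (x : R) (n : nat) :
  0 < x -> Im (log_Gamma_seq (RtoC x) n) = 0.
Proof.
  intros Hx.
  assert (H : forall m, Im (Clog_sum (RtoC x) m) = 0).
  { induction m as [ | m IH]; [easy | ]; cbn [Clog_sum].
    rewrite <- RtoC_plus, Clog_real by (pose proof (pos_INR m); lra).
    change (Im (Clog_sum x m) + 0 = 0); lra. }
  unfold log_Gamma_seq; specialize (H (S n)).
  set (s := Clog_sum (RtoC x) (S n)) in *.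
  clearbody s; unfold Im in *; cbn; lra.
Qed.

Lemma is_Cderive_log_Gamma_seq_line (z d : C) (n : nat) (s : R) :
  0 <= Re (z + RtoC s * d)%C -> (z + RtoC s * d)%C <> RtoC 0 ->
  exists l, is_Cderive (fun t => log_Gamma_seq (z + RtoC t * d) n) s l.
Proof.
  intros Hre Hz.
  assert (H : forall m, exists l, is_Cderive (fun t => Clog_sum (z + RtoC t * d) m) s l).
  { induction m as [ | m [l IH]].
    - exists (RtoC 0).
      exact (is_Cderive_real (fun _ => 0) s 0 (is_derive_const _ _)).
    - destruct (Re_nonneg_shift _ (INR m) Hre Hz (pos_INR m)) as [H1 H2].
      exists (l + d / ((z + RtoC s * d) + INR m))%C.
      apply (is_Cderive_plus _ _ _ _ _ IH).
      apply (is_Cderive_Clog (fun t => z + RtoC t * d + INR m)%C).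
      + now apply slit_plane_Re_nonneg.
      + refine (is_Cderive_ext (fun t => (z + INR m) + RtoC t * d)%C _ _ _ _
                  (is_Cderive_line _ _ _)).
        intros t; ring. }
  destruct (H (S n)) as [l Hl].
  eexists; unfold log_Gamma_seq; apply is_Cderive_minus; [ | exact Hl].
  apply is_Cderive_plus.
  - exact (is_Cderive_real (fun _ => ln (INR (fact n))) s 0 (is_derive_const _ _)).
  - apply is_Cderive_mult; [apply is_Cderive_line | ].
    exact (is_Cderive_real (fun _ => ln (INR n)) s 0 (is_derive_const _ _)).
Qed.

Lemma continuity_pt_Im_line (L : C -> C) (z d : C) (s : R) :
  @ex_derive C_AbsRing C_NormedModule L (z + RtoC s * d)%C ->
  continuity_pt (fun t => Im (L (z + RtoC t * d)%C)) s.
Proof.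
  intros HL; apply ex_derive_continuous in HL.
  intros eps Heps.
  destruct (HL (fun y => ball (Im (L (z + RtoC s * d)%C)) (mkposreal _ Heps) (Im y)))
    as [r Hr].
  { exact (ex_intro _ (mkposreal _ Heps) (fun y h => proj2 h)). }
  pose proof (Cmod_ge_0 d) as Hd; pose proof (cond_pos r) as Hrpos.
  exists (r / (Cmod d + 1)); split; [apply Rdiv_lt_0_compat; lra | ].
  intros t [_ Ht]; apply Hr.
  change (Cmod ((z + RtoC t * d) - (z + RtoC s * d)) < r).
  replace ((z + RtoC t * d) - (z + RtoC s * d))%C with (RtoC (t - s) * d)%C
    by (rewrite RtoC_minus; ring).
  rewrite Cmod_mult, Cmod_R.
  change (Rabs (t - s) < r / (Cmod d + 1)) in Ht.
  apply Rle_lt_trans with (Rabs (t - s) * (Cmod d + 1)).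
  - apply Rmult_le_compat_l; [apply Rabs_pos | lra].
  - apply (Rmult_lt_compat_r (Cmod d + 1)) in Ht; [ | lra].
    replace (r / (Cmod d + 1) * (Cmod d + 1)) with (pos r) in Ht by (field; lra); easy.
Qed.

(** A continuous function that stays within 1 of the multiples of [p] cannot cross
    [p / 2] or [- p / 2], so it cannot leave the neighbourhood of 0. *)
Lemma near_int_multiple_const (h : R -> R) (p : R) :
  3 <= p -> h 1 = 0 ->
  (forall s, 0 <= s <= 1 -> continuity_pt h s) ->
  (forall s, 0 <= s <= 1 -> exists m : Z, Rabs (h s - p * IZR m) <= 1) ->
  Rabs (h 0) <= 1.
Proof.
  intros Hp H1 Hc Hm.
  (* If [|h s| = p / 2], the nearest multiple of [p] is at distance [p / 2 > 1]. *)
  assert (Havoid : forall s, 0 <= s <= 1 -> Rabs (h s) <> p / 2).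
  { intros s Hs E; destruct (Hm s Hs) as [m Hms].
    apply Rabs_le_between in Hms.
    assert (H2 : h s = p / 2 \/ h s = - (p / 2)).
    { unfold Rabs in E; destruct (Rcase_abs (h s)); lra. }
    destruct (Z.le_gt_cases m (-1)) as [Hm1 | Hm1].
    - apply IZR_le in Hm1; nra.
    - destruct (Z.le_gt_cases m 0) as [Hm0 | Hm0].
      + replace m with 0%Z in Hms by lia; lra.
      + assert (Hm2 : (1 <= m)%Z) by lia; apply IZR_le in Hm2; nra. }
  assert (Hsmall : Rabs (h 0) < p / 2).
  { destruct (Rtotal_order (Rabs (h 0)) (p / 2)) as [ | [E | Hgt]]; [easy | | ].
    - now elim (Havoid 0 ltac:(lra)).
    - destruct (IVT_interv (fun s => p / 2 - Rabs (h s)) 0 1) as [s [Hs E]].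
      + intros s Hs; apply continuity_pt_minus.
        * apply continuity_pt_const; easy.
        * apply (continuity_pt_comp h Rabs); [now apply Hc | apply Rcontinuity_abs].
      + lra.
      + lra.
      + rewrite H1, Rabs_R0; lra.
      + elim (Havoid s Hs); lra. }
  destruct (Hm 0 ltac:(lra)) as [m Hm0].
  apply Rabs_lt_between in Hsmall.
  replace m with 0%Z in Hm0; [now rewrite Rmult_0_r, Rminus_0_r in Hm0 | ].
  apply Rabs_le_between in Hm0.
  destruct (Z.le_gt_cases m (-1)) as [Hm1 | Hm1].
  - apply IZR_le in Hm1; nra.
  - destruct (Z.le_gt_cases m 0) as [ | Hm2]; [lia | ].
    assert (Hm3 : (1 <= m)%Z) by lia; apply IZR_le in Hm3; nra.
Qed.

(** The limit [F] of [log_Gamma_seq z] satisfies [Cexp F = Cexp (L z)], so they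
    differ by an integer multiple of [2 PI i]. Along the segment from [z] to 1 this
    integer is followed by the continuous function [Im (L - log_Gamma_seq N)], with
    one [N] for the whole segment; it is 0 at 1, where all values are real. *)
Lemma ln_Gamma_eq_lim (L : C -> C) (z : C) :
  is_ln_Gamma L -> 0 <= Re z -> z <> RtoC 0 -> is_lim_Cseq (log_Gamma_seq z) (L z).
Proof.
  intros [HL [Hexp Hreal]] Hre Hz.
  pose proof PI2_3_2 as Hpi.
  set (d := (1 - z)%C).
  set (p := fun s : R => (z + RtoC s * d)%C).
  assert (Hp : forall s, 0 <= s <= 1 -> 0 <= Re (p s) /\ p s <> RtoC 0).
  { intros s Hs.
    assert (ERe : Re (p s) = (1 - s) * Re z + s).
    { unfold p, d, Re in *; cbn; ring. }
    assert (H0 : 0 <= (1 - s) * Re z) by (apply Rmult_le_pos; lra).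
    destruct (Req_dec s 0) as [-> | Hs0].
    - replace (p 0) with z by (unfold p; ring); easy.
    - split; [lra | apply Re_pos_neq_0; lra]. }
  assert (HM : 0 <= Cmod z + Cmod d).
  { pose proof (Cmod_ge_0 z); pose proof (Cmod_ge_0 d); lra. }
  destruct (log_Gamma_seq_unif_cauchy _ 1 HM Rlt_0_1) as [N HN].
  assert (Hbranch : forall s, 0 <= s <= 1 -> exists F (m : Z),
    is_lim_Cseq (log_Gamma_seq (p s)) F /\ Re (L (p s)) = Re F /\
    Im (L (p s)) = Im F + 2 * PI * IZR m /\
    Rabs (Im (L (p s)) - Im (log_Gamma_seq (p s) N) - 2 * PI * IZR m) <= 1).
  { intros s Hs; destruct (Hp s Hs) as [H1 H2].
    destruct (Gamma_eq_exp_lim (p s) H1 H2) as [F [HF HG]].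
    assert (E : Cexp (L (p s)) = Cexp F).
    { now rewrite Hexp by now apply slit_plane_Re_nonneg. }
    destruct (Cexp_eq_inv _ _ E) as [ERe [m EIm]].
    exists F, m; repeat split; try easy; try apply HF.
    assert (Hle : Cmod (F - log_Gamma_seq (p s) N) <= 1).
    { apply (Cmod_lim_le (log_Gamma_seq (p s)) _ _ (fun _ => 0)).
      - easy.
      - apply is_lim_seq_const.
      - exists N; intros n Hn; rewrite Rplus_0_r; left; apply HN; try easy.
        unfold p; eapply Rle_trans; [apply Cmod_triangle | ].
        rewrite Cmod_mult, Cmod_R, Rabs_pos_eq by lra.
        pose proof (Cmod_ge_0 d); nra. }
    rewrite EIm.
    replace (Im F + 2 * PI * IZR m - Im (log_Gamma_seq (p s) N) - 2 * PI * IZR m)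
      with (Im (F - log_Gamma_seq (p s) N)).
    - eapply Rle_trans; [apply Im_le_Cmod | exact Hle].
    - change (Im (F - log_Gamma_seq (p s) N))
        with (Im F - Im (log_Gamma_seq (p s) N)); ring. }
  assert (Hsmall : Rabs (Im (L (p 0)) - Im (log_Gamma_seq (p 0) N)) <= 1).
  { apply (near_int_multiple_const
      (fun s => Im (L (p s)) - Im (log_Gamma_seq (p s) N)) (2 * PI)).
    - lra.
    - replace (p 1) with (RtoC 1) by (unfold p, d; ring).
      rewrite Im_log_Gamma_seq_real by lra.
      destruct (Hreal 1 Rlt_0_1) as [E _]; rewrite E; ring.
    - intros s Hs; destruct (Hp s Hs) as [H1 H2].
      apply continuity_pt_minus.
      + apply continuity_pt_Im_line, HL, slit_plane_Re_nonneg; easy.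
      + destruct (is_Cderive_log_Gamma_seq_line z d N s H1 H2) as [l [_ Hl]].
        apply derivable_continuous_pt; exists (Im l); now apply is_derive_Reals.
    - intros s Hs; destruct (Hbranch s Hs) as [F [m [_ [_ [_ Hm]]]]]; now exists m. }
  destruct (Hbranch 0 ltac:(lra)) as [F [m [HF [ERe [EIm Hm]]]]].
  replace (p 0) with z in * by (unfold p; ring).
  replace (L z) with F; [easy | ].
  assert (Em : m = 0%Z).
  { apply Rabs_le_between in Hsmall; apply Rabs_le_between in Hm.
    destruct (Z.le_gt_cases m (-1)) as [H | H].
    - apply IZR_le in H; nra.
    - destruct (Z.le_gt_cases m 0) as [ | H']; [lia | ].
      assert (H1 : (1 <= m)%Z) by lia; apply IZR_le in H1; nra. }
  rewrite Em in EIm.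
  apply injective_projections; [symmetry; exact ERe | ].
  change (Im F = Im (L z)); rewrite EIm; ring.
Qed.

Lemma Cmod_shift_sqr_ge (z : C) (u : R) :
  0 <= Re z -> 0 <= u ->
  Cmod z * Cmod z + u * u <= Cmod (z + u) * Cmod (z + u).
Proof.
  intros Hre Hu; rewrite !Cmod_sqr.
  change (Re (z + u)) with (Re z + u); change (Im (z + u)) with (Im z + 0); nra.
Qed.

(** On the closed right half-plane [|z + u|^2 >= |z|^2 + u^2], so [em_defect k z n]
    is at most a multiple of the integral of [(|z|^2 + u^2)^-k] from 0 to infinity,
    a Wallis integral. *)
Lemma stirling_error_le (L : C -> C) (k : nat) (z : C) :
  is_ln_Gamma L -> (1 <= k)%nat -> 0 <= Re z -> z <> RtoC 0 ->
  Cmod (L z - stirling_sum k z) <=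
  Rabs (bernoulli (2 * k)) / INR (2 * k) * (wallis (2 * (k - 1)) / Cmod z ^ (2 * k - 1)).
Proof.
  intros HL Hk Hre Hz.
  set (b := Rabs (bernoulli (2 * k)) / INR (2 * k)).
  assert (Hb : 0 <= b).
  { apply Rmult_le_pos; [apply Rabs_pos | ].
    left; apply Rinv_0_lt_compat, lt_0_INR; lia. }
  assert (Hr : 0 < Cmod z) by now apply Cmod_gt_0.
  set (r := Cmod z) in *.
  destruct (log_Gamma_seq_gap_le k r (Cmod_ge_0 z)) as [e [He Hgap]].
  apply (Cmod_lim_le (log_Gamma_seq z) _ _ e); [now apply ln_Gamma_eq_lim | easy | ].
  exists 1%nat; intros n Hn.
  specialize (Hgap n z Hn Hre (Rle_refl _)).
  replace (log_Gamma_seq z n - stirling_sum k z)%C with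
    ((log_Gamma_seq z n - stirling_sum k z - em_defect k z (S n))
     + (em_defect k z (S n) - em_defect k z 0))%C.
  2: { unfold em_defect at 3; cbn [Clog_sum INR]; rewrite Cplus_0_r; ring. }
  eapply Rle_trans; [apply Cmod_triangle | ].
  rewrite Rplus_comm; apply Rplus_le_compat; [ | exact Hgap].
  eapply Rle_trans.
  { apply (em_defect_le k z (fun u => b * inv_pow_int r (k - 1) u)
             (fun u => b * / (r * r + u * u) ^ S (k - 1))); [easy | easy | easy | | | lia].
    - intros u _; apply is_derive_scal, is_derive_inv_pow_int, Hr.
    - intros u Hu; cbn [INR] in Hu.
      replace (S (k - 1)) with k by lia.
      apply Rmult_le_compat_l; [easy | ].
      assert (Hpos : 0 < r * r + u * u) by nra.
      apply Rinv_le_contravar; [now apply pow_lt | ].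
      rewrite pow_mult; apply pow_incr; split; [lra | ].
      pose proof (Cmod_shift_sqr_ge z u Hre ltac:(lra)) as H; fold r in H.
      cbn [pow]; rewrite Rmult_1_r; exact H. }
  cbn [INR].
  assert (E0 : inv_pow_int r (k - 1) 0 = 0).
  { unfold inv_pow_int, cos_pow_int.
    replace (0 / r) with 0 by (unfold Rdiv; ring).
    rewrite atan_0, RInt_point; unfold zero; cbn; unfold Rdiv; ring. }
  rewrite E0, Rmult_0_r, Rminus_0_r.
  apply Rmult_le_compat_l; [easy | ].
  unfold inv_pow_int; replace (2 * (k - 1) + 1)%nat with (2 * k - 1)%nat by lia.
  apply Rmult_le_compat_r; [left; now apply Rinv_0_lt_compat, pow_lt | ].
  apply cos_pow_int_le; split.
  - rewrite <- atan_0.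
    assert (H : 0 < INR (S n) / r) by (apply Rdiv_lt_0_compat; [apply lt_0_INR; lia | easy]).
    left; now apply atan_increasing.
  - left; apply atan_bound.
Qed.

(** * The bounds on the remainder *)

Theorem corollary1 (lnGamma : C -> C) (HlnGamma : is_ln_Gamma lnGamma)
    (k : nat) (hk : (1 <= k)%nat) (z : C) (hRe : 0 <= Re z) (hz : z <> RtoC 0) :
  Cmod (stirling_remainder lnGamma (k + 1) z / T k z)%C < sqrt (PI * INR k) /\
  Cmod (stirling_remainder lnGamma k z / T k z)%C < 1 + sqrt (PI * INR k).
Proof.
  assert (E1 : stirling_remainder lnGamma (k + 1) z = (lnGamma z - stirling_sum k z)%C).
  { unfold stirling_remainder; now replace (k + 1 - 1)%nat with k by lia. }
  assert (E2 : stirling_remainder lnGamma k z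
               = (lnGamma z - stirling_sum k z + T k z)%C).
  { change (stirling_remainder lnGamma k z) with (lnGamma z - stirling_sum (k - 1) z)%C.
    replace k with (S (k - 1)) at 2 3 by lia.
    rewrite stirling_sum_S; ring. }
  rewrite E1, E2; clear E1 E2.
  pose proof PI_RGT_0 as Hpi.
  assert (Hsq : 0 < sqrt (PI * INR k)).
  { apply sqrt_lt_R0, Rmult_lt_0_compat; [easy | apply lt_0_INR; lia]. }
  destruct (Ceq_dec (T k z) 0) as [HT | HT].
  (* Division by 0 yields 0, so both quotients vanish here. *)
  { assert (H0 : forall x, (x / T k z)%C = RtoC 0).
    { intros x; rewrite HT; unfold Cdiv.
      replace (/ RtoC 0)%C with (RtoC 0); [ring | ].
      unfold Cinv, RtoC; cbn; apply injective_projections; cbn; unfold Rdiv; ring. }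
    rewrite !H0, Cmod_0; lra. }
  pose proof (stirling_error_le lnGamma k z HlnGamma hk hRe hz) as Herr.
  set (E := (lnGamma z - stirling_sum k z)%C) in *.
  assert (Hr : 0 < Cmod z) by now apply Cmod_gt_0.
  assert (Hmain : Cmod (E / T k z) < sqrt (PI * INR k)).
  { apply Rle_lt_trans with (INR (2 * k) * wallis (2 * k)); [ | now apply wallis_even_lt].
    rewrite Cmod_div by easy.
    assert (HTpos : 0 < Cmod (T k z)) by now apply Cmod_gt_0.
    apply (Rmult_le_reg_r (Cmod (T k z))); [easy | ].
    replace (Cmod E / Cmod (T k z) * Cmod (T k z)) with (Cmod E) by (field; lra).
    apply Rle_trans with (1 := Herr); right.
    pose proof (wallis_recurrence (2 * (k - 1))) as Hw.
    replace (S (S (2 * (k - 1)))) with (2 * k)%nat in Hw by lia.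
    replace (S (2 * (k - 1))) with (2 * k - 1)%nat in Hw by lia.
    rewrite Hw.
    assert (Hn : INR (2 * k * (2 * k - 1)) <> 0) by (apply not_0_INR; nia).
    unfold T; rewrite Cmod_div, Cmod_mult, Cmod_pow, !Cmod_R.
    2: { apply Cmult_neq_0; [ | now apply Cpow_nz].
         intros E'; apply RtoC_inj in E'; easy. }
    rewrite (Rabs_pos_eq (INR _)) by apply pos_INR.
    rewrite (mult_INR (2 * k)); field.
    repeat split; try (apply not_0_INR; lia).
    apply Rgt_not_eq, pow_lt, Hr. }
  split; [easy | ].
  replace ((E + T k z) / T k z)%C with (1 + E / T k z)%C by (field; easy).
  eapply Rle_lt_trans; [apply Cmod_triangle | ].
  rewrite Cmod_R, Rabs_pos_eq by lra; lra.
Qed.
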